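(* Suppose that $G=G_1*_{G_0} G_2$ is an amalgamated free product, where $G_0$ is virtually cyclic and $G_0$ is a virtual retract of $G_i$, for $i=1,2$. Then \begin{itemize} \item[(i)] for each $i=1,2$, every finitely generated virtually abelian subgroup $H\leqslant G_i$ that is a virtual retract of $G_i$ is a virtual retract of $G$; in particular, $G_0$ is a virtual retract of $G$. \item[(ii)] If $|G_0|<\infty$ then there is a finite index normal subgroup $F\lhd G$ such that $F=F_0*F_1*\dots*F_k$, where $k\in\{0,1,2,\dots\}$, $F_0$ is a finitely generated free group (possibly trivial) and each $F_j$, $1\le j\le k$, is isomorphic to a finite index subgroup of some $G_i$, for $i=i(j)\in\{1,2\}$. \item[(iii)] If $G_0$ is infinite then there is a finite index normal subgroup $K\lhd G$ isomorphic to a semidirect product \[K\cong(N_0*N_1*\dots*N_k)\rtimes\mathbb{Z},\] where $k\in\{0,1,2,\dots\}$, $N_0$ is a finitely generated free group (possibly trivial), and for each $j=1,\dots,k$ there is $i=i(j)\in\{1,2\}$ such that $N_j$ is isomorphic to some normal subgroup $M_j\lhd(G_i\cap K)$ with $(G_i\cap K)/M_j\cong\mathbb{Z}$. \end{itemize}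
   Context: A subgroup $H$ of a group $G$ is a virtual retract of $G$ if there are a finite index subgroup $K\leqslant G$ containing $H$ and a homomorphism $\rho:K\to H$ with $\rho|_H=\mathrm{Id}_H$. A group is virtually abelian (virtually cyclic) if it has a finite index abelian (respectively, cyclic) subgroup; finite groups are virtually cyclic. *)

(* Defs.v *)
(* MathComp, with possibly infinite groups as [groupType] and subgroups as
   classical sets. *)
From HB Require Import structures.
From mathcomp Require Import all_boot ssralg ssrint.
From mathcomp Require Import boolp classical_sets functions cardinality.

Set Implicit Arguments.
Unset Strict Implicit.
Unset Printing Implicit Defensive.

Local Open Scope classical_set_scope.
Local Open Scope group_scope.

Notation intgrp := (Algebra.to_multiplicative int).

Section Subgroups.
Variable G : groupType.
Implicit Types (A H K M X : set G) (x y : G).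

Definition subgroup H :=
  [/\ H 1, forall x y, H x -> H y -> H (x * y) & forall x, H x -> H x^-1].

Definition generated X : set G := smallest subgroup X.

Definition finitely_generated H :=
  exists X, finite_set X /\ H = generated X.

Definition cyclic_subgroup H := exists x, H = generated [set x].

Definition abelian_subgroup H :=
  subgroup H /\ forall x y, H x -> H y -> commute x y.

Definition lcoset x H : set G := [set x * h | h in H].

Definition lcosets A H : set (set G) := [set lcoset x H | x in A].

Definition finite_index_subgroup H A :=
  [/\ subgroup H, H `<=` A & finite_set (lcosets A H)].

Definition normal_subgroup H A :=
  [/\ subgroup H, H `<=` A & forall x y, A x -> H y -> H (y ^ x)].

Definition virtually_abelian A :=
  exists H, finite_index_subgroup H A /\ abelian_subgroup H.

Definition virtually_cyclic A :=
  exists H, finite_index_subgroup H A /\ cyclic_subgroup H.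

End Subgroups.

(* A homomorphism from a subgroup A is represented by a function on the ambient
   group whose values outside A are irrelevant. *)
Definition hom_on (G T : groupType) (A : set G) (f : G -> T) :=
  forall x y, A x -> A y -> f (x * y) = f x * f y.

Definition isog (G T : groupType) (A : set G) (B : set T) :=
  exists f : G -> T, hom_on A f /\ set_bij A B f.

(* A / M is isomorphic to T: cosets are multiplied by (xM)(yM) = (xy)M. *)
Definition quotient_isog (G T : groupType) (A M : set G) :=
  exists f : set G -> T,
    (forall x y, A x -> A y ->
       f (lcoset (x * y) M) = f (lcoset x M) * f (lcoset y M)) /\
    set_bij (lcosets A M) [set: T] f.
Arguments quotient_isog {G} T A M.

Definition virtual_retract (G : groupType) (H : set G) :=
  exists (K : set G) (rho : G -> G),
    [/\ finite_index_subgroup K [set: G], H `<=` K, hom_on K rho,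
        forall x, K x -> H (rho x) & forall x, H x -> rho x = x].

(* G is the amalgamated free product of G1 and G2 along the embeddings f1, f2
   of G0, with canonical maps j1, j2. *)
Definition amalgamated_product (G0 G1 G2 G : groupType)
    (f1 : {multiplicative G0 -> G1}) (f2 : {multiplicative G0 -> G2})
    (j1 : {multiplicative G1 -> G}) (j2 : {multiplicative G2 -> G}) :=
  [/\ injective f1, injective f2, j1 \o f1 =1 j2 \o f2 &
      forall (T : groupType)
             (h1 : {multiplicative G1 -> T}) (h2 : {multiplicative G2 -> T}),
        h1 \o f1 =1 h2 \o f2 ->
        (exists h : {multiplicative G -> T}, h \o j1 =1 h1 /\ h \o j2 =1 h2) /\
        (forall h h' : {multiplicative G -> T},
           h \o j1 =1 h' \o j1 -> h \o j2 =1 h' \o j2 -> h =1 h')].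

(* The subgroup A is the internal free product of its subgroups B i. *)
Definition free_product (G : groupType) (I : Type) (A : set G)
    (B : I -> set G) :=
  [/\ subgroup A, forall i, subgroup (B i) /\ B i `<=` A &
      forall (T : groupType) (b : I -> G -> T),
        (forall i, hom_on (B i) (b i)) ->
        (exists h : G -> T,
           hom_on A h /\ forall i x, B i x -> h x = b i x) /\
        (forall h h' : G -> T, hom_on A h -> hom_on A h' ->
           (forall i x, B i x -> h x = h' x) -> forall x, A x -> h x = h' x)].

Definition free_basis (G : groupType) (A X : set G) :=
  [/\ subgroup A, X `<=` A &
      forall (T : groupType) (b : G -> T),
        (exists h : G -> T, hom_on A h /\ forall x, X x -> h x = b x) /\
        (forall h h' : G -> T, hom_on A h -> hom_on A h' ->
           (forall x, X x -> h x = h' x) -> forall x, A x -> h x = h' x)].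

Definition free_group (G : groupType) (A : set G) :=
  exists X : set G, free_basis A X.

Definition isog_finite_index (G T : groupType) (A : set G) :=
  exists B : set T, finite_index_subgroup B [set: T] /\ isog A B.
Arguments isog_finite_index {G} T A.

(* N is isomorphic to some normal subgroup M of A with A / M infinite cyclic. *)
Definition isog_cocyclic_normal (P G : groupType) (N : set P) (A : set G) :=
  exists M : set G,
    [/\ normal_subgroup M A, quotient_isog intgrp A M & isog N M].

Record aut_action (Q N : groupType) := AutAction {
  act :> Q -> N -> N;
  actM : forall q, {morph act q : x y / x * y};
  act1 : forall x, act 1 x = x;
  act_comp : forall q r x, act (q * r) x = act q (act r x)
}.

Definition sdprod (Q N : groupType) (a : aut_action Q N) : Type := (N * Q)%type.

Section SemidirectProduct.
Variables (Q N : groupType) (a : aut_action Q N).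

HB.instance Definition _ := Choice.copy (sdprod a) (N * Q)%type.

Implicit Types u v w : sdprod a.

Definition sdprod_one : sdprod a := (1, 1).
Definition sdprod_mul u v : sdprod a := (u.1 * a u.2 v.1, u.2 * v.2).
Definition sdprod_inv u : sdprod a := (a u.2^-1 u.1^-1, u.2^-1).

Lemma act_one q : a q 1 = 1.
Proof. by apply: (mulgI (a q 1)); rewrite -actM !mulg1. Qed.

Lemma sdprod_mulA : associative sdprod_mul.
Proof. by move=> u v w; rewrite /sdprod_mul /= actM act_comp !mulgA. Qed.

Lemma sdprod_mul1 : left_id sdprod_one sdprod_mul.
Proof. by case=> x q; rewrite /sdprod_mul /= act1 !mul1g. Qed.

Lemma sdprod_mulr1 : right_id sdprod_one sdprod_mul.
Proof. by case=> x q; rewrite /sdprod_mul /= act_one !mulg1. Qed.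

Lemma sdprod_mulV : left_inverse sdprod_one sdprod_inv sdprod_mul.
Proof.
by case=> x q; rewrite /sdprod_mul /sdprod_inv /= -actM !mulVg act_one.
Qed.

Lemma sdprod_mulrV : right_inverse sdprod_one sdprod_inv sdprod_mul.
Proof.
case=> x q; rewrite /sdprod_mul /sdprod_inv /=.
by rewrite -act_comp !mulgV act1 mulgV.
Qed.

HB.instance Definition _ := isGroup.Build (sdprod a)
  sdprod_mulA sdprod_mul1 sdprod_mulr1 sdprod_mulV sdprod_mulrV.

End SemidirectProduct.

(* Main.v *)
(* The edge group G0 has a finite index subgroup that is trivial or infinite
   cyclic. Write a virtual retract H <= G1 through a homomorphism w from a finite
   index normal subgroup M1 of G1 to a free abelian group V that is a power map on
   H, and let u : M2 -> Z be the analogous homomorphism for G0 <= G2. After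
   adjusting M1 and M2 so that they meet G0 in the same subgroup M0, the group G
   acts on the finite set G1/M1 * G2/M2 so that the kernel K meets G1 inside M1.
   Homomorphisms K -> V are cocycles on this G-set; giving the generator of M0 the
   weight W(x) U(y) at the point (x, y), where W and U are the values of w and u
   on its conjugates, is compatible with both vertex groups and yields a
   homomorphism K -> V extending a multiple of w. Averaging it over H/(H :&: K)
   turns it into a virtual retraction onto H, which is (i).

   For (ii) and (iii) let N be a subgroup meeting all conjugates of G0 trivially
   and having finitely many double cosets G0 x N. A transversal of N adapted to a
   spanning tree of the quotient by N of the Bass-Serre tree exhibits N as a free
   product; its universal property follows from that of G, since a homomorphism
   from N to T is the restriction to N of a cocycle with values in T. In (ii), N is
   the kernel K. In (iii), N is the kernel of a homomorphism K -> Z that is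
   nonzero on every conjugate of G0 :&: K: a generic combination of the conjugates
   of one that is nonzero on G0 :&: K, which exists by (i). *)
Require Import Defs.
From HB Require Import structures.
From mathcomp Require Import all_boot ssralg ssrint.
From mathcomp Require Import boolp classical_sets functions cardinality.
From mathcomp Require Import ssrnum intdiv poly.

Set Implicit Arguments.
Unset Strict Implicit.
Unset Printing Implicit Defensive.

Local Open Scope classical_set_scope.
Local Open Scope group_scope.

(** A retraction of G1 onto H need not extend to G: on conjugates of the edge group its values are
    dictated by G1, and G2 need not produce the same ones. With values in an abelian group the
    mismatch becomes one of integers, and multiplying the values on each side by those of the other
    side removes it. Hence only a multiple of w extends, and power maps take the place of
    retractions; since the target is torsion-free, the power can be undone at the end. All
    conjugates must be matched at once, which is why the cocycles live on a finite G-set on which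
    every stabilizer in G0 is M0. Only the universal property of G is available. It is applied to
    permutation groups, so that maps out of G are built as actions: a cocycle with values in T is an
    action on T x G, and even generation of G by the factors and injectivity of G1 -> G are read off
    suitable actions. In (iii), a homomorphism to Z that is nonzero on one conjugate of the edge
    group may vanish on another, and its kernel would then fix an edge. Being nonzero on all of them
    also gives the finiteness of the double cosets: each conjugate then has an image of finite index
    in Z. *)

Ltac gsimp :=
  rewrite ?(invgM, invgK, invg1, mulgA, mulgK, mulgVK, mulgV, mulVg, mul1g, mulg1).

(** * Subgroups, permutation groups and amalgams *)

Lemma right_inverse_on_range (T U : Type) (u0 : U) (f : U -> T) :
  exists g : T -> U, forall x, range f x -> f (g x) = x.
Proof.
suff /choice[g gP] : forall x, exists u, range f x -> f u = x by exists g.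
move=> x; have [[u _ <-]|nx] := pselect (range f x); first by exists u.
by exists u0.
Qed.

Section SubgroupFacts.
Variables (G : groupType) (H : set G).
Hypothesis sH : subgroup H.

Lemma sub1 : H 1. Proof. by case: sH. Qed.
Lemma subM x y : H x -> H y -> H (x * y). Proof. by case: sH => _ + _; apply. Qed.
Lemma subV x : H x -> H x^-1. Proof. by case: sH => _ _; apply. Qed.
Lemma subX n x : H x -> H (x ^+ n).
Proof.
move=> Hx; elim: n => [|n IH]; first exact: sub1.
by rewrite expgS; apply: subM.
Qed.
Lemma subMl x y : H x -> H (x * y) = H y.
Proof.
move=> Hx; apply/propext; split => [|Hy]; last exact: subM.
by move=> /(subM (subV Hx)); rewrite mulKg.
Qed.
Lemma subMr x y : H y -> H (x * y) = H x.
Proof.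
move=> Hy; apply/propext; split => [|Hx]; last exact: subM.
by move=> /subM /(_ (subV Hy)); rewrite mulgK.
Qed.
End SubgroupFacts.

Lemma subgroupT (G : groupType) : subgroup [set: G]. Proof. by []. Qed.

Lemma subgroupI (G : groupType) (H K : set G) :
  subgroup H -> subgroup K -> subgroup (H `&` K).
Proof.
move=> sH sK; split; first by split; apply: sub1.
  by move=> x y [? ?] [? ?]; split; apply: subM.
by move=> x [? ?]; split; apply: subV.
Qed.

Section HomOn.
Variables (G T : groupType) (A : set G) (f : G -> T).
Hypotheses (sA : subgroup A) (fM : hom_on A f).

Lemma hom_on1 : f 1 = 1.
Proof.
by apply: (mulgI (f 1)); rewrite -fM ?mulg1 //; apply: sub1.
Qed.

Lemma hom_onV x : A x -> f x^-1 = (f x)^-1.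
Proof.
move=> Ax; apply: (mulgI (f x)); rewrite -fM ?mulgV ?hom_on1 //.
exact: subV.
Qed.

Lemma hom_onX x n : A x -> f (x ^+ n) = f x ^+ n.
Proof.
move=> Ax; elim: n => [|n IH]; first exact: hom_on1.
by rewrite !expgS fM ?IH //; apply: subX.
Qed.

Lemma subgroup_ker_on (B : set T) : subgroup B -> subgroup [set x | A x /\ B (f x)].
Proof.
move=> sB; split => /=.
- by split; [apply: sub1|rewrite hom_on1; apply: sub1].
- by move=> x y [Ax Bx] [Ay By]; split; [apply: subM|rewrite fM//; apply: subM].
- by move=> x [Ax Bx]; split; [apply: subV|rewrite hom_onV//; apply: subV].
Qed.

Lemma subgroup_image_on : subgroup (f @` A).
Proof.
split.
- by exists 1; [apply: sub1|apply: hom_on1].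
- move=> _ _ [x Ax <-] [y Ay <-]; exists (x * y); first exact: subM.
  exact: fM.
- move=> _ [x Ax <-]; exists x^-1; first exact: subV.
  exact: hom_onV.
Qed.
End HomOn.

Section Generated.
Variables (G : groupType) (X : set G).

Lemma subgroup_generated : subgroup (generated X).
Proof.
split.
- by move=> B [sB _]; apply: sub1.
- move=> x y gx gy B /[dup] BX [sB _]; apply: subM => //; [exact: gx|exact: gy].
- by move=> x gx B /[dup] BX [sB _]; apply: subV => //; exact: gx.
Qed.

Lemma sub_generated x : X x -> generated X x.
Proof. by move=> Xx B [_]; apply. Qed.

Lemma generated_sub (H : set G) : subgroup H -> X `<=` H -> generated X `<=` H.
Proof. by move=> sH XH x; apply. Qed.
End Generated.

Lemma subgroup_eq_on (G T : groupType) (A : set G) (f g : G -> T) :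
  subgroup A -> hom_on A f -> hom_on A g -> subgroup [set x | A x /\ f x = g x].
Proof.
move=> sA fM gM; split => /=.
- by split; [apply: sub1|rewrite (hom_on1 sA fM) (hom_on1 sA gM)].
- by move=> y z [Ay ey] [Az ez]; split; [apply: subM|rewrite fM// gM// ey ez].
- move=> y [Ay ey]; split; first exact: subV.
  by rewrite (hom_onV sA fM)// (hom_onV sA gM)// ey.
Qed.

Lemma hom_on_generated (G T : groupType) (X A : set G) (f g : G -> T) :
  subgroup A -> X `<=` A -> hom_on A f -> hom_on A g ->
  (forall x, X x -> f x = g x) -> forall x, generated X x -> f x = g x.
Proof.
move=> sA XA fM gM fg x gx.
have [] : [set x | A x /\ f x = g x] x; last by [].
apply: generated_sub gx; first exact: subgroup_eq_on.
by move=> y Xy; split; [apply: XA|apply: fg].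
Qed.

(** Permutation groups are the targets to which the universal property is applied: actions of the
    two factors that agree over [G0] glue to an action of [G]. The inverse is stored as data, so
    that the group operations need no choice. *)
Record bij (X : Type) := Bij {
  bij_fun : X -> X;
  bij_inv : X -> X;
  bij_funK : cancel bij_fun bij_inv;
  bij_invK : cancel bij_inv bij_fun }.

HB.instance Definition _ X := gen_eqMixin (bij X).
HB.instance Definition _ X := gen_choiceMixin (bij X).

Section BijGroup.
Variable X : Type.
Implicit Types u v w : bij X.

Lemma bij_ext u v : bij_fun u =1 bij_fun v -> u = v.
Proof.
case: u v => [f f' fK f'K] [g g' gK g'K] /= /funext fg; subst g.
have e : f' = g' by apply/funext => x; rewrite -{1}(g'K x) fK.
by subst g'; congr Bij; apply: Prop_irrelevance.
Qed.

Definition bij_one : bij X := @Bij X id id (fun=> erefl) (fun=> erefl).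
Definition bij_mul u v : bij X :=
  Bij (can_comp (bij_funK u) (bij_funK v)) (can_comp (bij_invK v) (bij_invK u)).
Definition bij_opp u : bij X := Bij (bij_invK u) (bij_funK u).

Lemma bij_mulA : associative bij_mul.
Proof. by move=> u v w; apply: bij_ext. Qed.
Lemma bij_mul1 : left_id bij_one bij_mul.
Proof. by move=> u; apply: bij_ext. Qed.
Lemma bij_mulr1 : right_id bij_one bij_mul.
Proof. by move=> u; apply: bij_ext. Qed.
Lemma bij_mulV : left_inverse bij_one bij_opp bij_mul.
Proof. by move=> u; apply: bij_ext => x /=; rewrite bij_funK. Qed.
Lemma bij_mulrV : right_inverse bij_one bij_opp bij_mul.
Proof. by move=> u; apply: bij_ext => x /=; rewrite bij_invK. Qed.

HB.instance Definition _ := isGroup.Build (bij X)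
  bij_mulA bij_mul1 bij_mulr1 bij_mulV bij_mulrV.
End BijGroup.

Lemma morph_multiplicative (G T : groupType) (f : G -> T) :
  {morph f : x y / x * y} -> exists h : {multiplicative G -> T}, h =1 f.
Proof.
move=> fM; pose M := isMultiplicative.Build G T f fM.
by exists (HB.pack_for {multiplicative G -> T} f M).
Qed.

Definition is_action (G : groupType) (X : Type) (a : G -> X -> X) :=
  (forall x, a 1 x = x) /\ forall g h x, a (g * h) x = a g (a h x).

Lemma action_bij (G : groupType) (X : Type) (a : G -> X -> X) :
  is_action a ->
  exists h : {multiplicative G -> bij X}, forall g x, bij_fun (h g) x = a g x.
Proof.
case=> a1 aM.
have aK g : cancel (a g) (a g^-1) by move=> x; rewrite -aM mulVg.
have aVK g : cancel (a g^-1) (a g) by move=> x; rewrite -aM mulgV.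
have [|h hE] := @morph_multiplicative G (bij X) (fun g => Bij (aK g) (aVK g)).
  by move=> g h; apply: bij_ext => x /=; rewrite aM.
by exists h => g x; rewrite hE.
Qed.

Lemma bij_is_action (G : groupType) (X : Type)
  (h : {multiplicative G -> bij X}) : is_action (fun g => bij_fun (h g)).
Proof.
split=> [x|g g' x]; last by rewrite gmulfM.
suff -> : h 1 = 1 by [].
by apply: (mulgI (h 1)); rewrite -gmulfM !mulg1.
Qed.

Lemma amalgamated_product_sym (G0 G1 G2 G : groupType)
    (f1 : {multiplicative G0 -> G1}) (f2 : {multiplicative G0 -> G2})
    (j1 : {multiplicative G1 -> G}) (j2 : {multiplicative G2 -> G}) :
  amalgamated_product f1 f2 j1 j2 -> amalgamated_product f2 f1 j2 j1.
Proof.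
case=> i1 i2 e U; split=> // T h1 h2 h12.
have [|[h [hj1 hj2]] uh] := U T h2 h1; first by move=> x; rewrite -h12.
by split; [exists h|move=> h' h'' e1 e2; apply: uh].
Qed.

Section Amalgam.
Variables (G0 G1 G2 G : groupType).
Variables (f1 : {multiplicative G0 -> G1}) (f2 : {multiplicative G0 -> G2}).
Variables (j1 : {multiplicative G1 -> G}) (j2 : {multiplicative G2 -> G}).
Hypothesis am : amalgamated_product f1 f2 j1 j2.

Lemma glue_action (X : Type) (a1 : G1 -> X -> X) (a2 : G2 -> X -> X) :
  is_action a1 -> is_action a2 -> (forall c x, a1 (f1 c) x = a2 (f2 c) x) ->
  exists a : G -> X -> X, [/\ is_action a,
    forall g x, a (j1 g) x = a1 g x & forall g x, a (j2 g) x = a2 g x].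
Proof.
move=> /action_bij[h1 h1E] /action_bij[h2 h2E] e12.
case: am => _ _ _ /(_ (bij X) h1 h2)[].
  by move=> c; apply: bij_ext => x /=; rewrite h1E h2E.
case=> h [hj1 hj2] _; exists (fun g => bij_fun (h g)); split.
- exact: bij_is_action.
- by move=> g x; rewrite -h1E -hj1.
- by move=> g x; rewrite -h2E -hj2.
Qed.

(* The swap of (x, true) and (x, false) for x in P commutes with j1 and j2,
   hence with all of G. *)
Lemma amalgam_ind (P : G -> Prop) :
  P 1 -> (forall g x, P x -> P (j1 g * x)) -> (forall g x, P x -> P (j2 g * x)) ->
  forall x, P x.
Proof.
have jV (G' : groupType) (j : {multiplicative G' -> G}) g : j g^-1 * j g = 1.
  apply: (mulgI (j g)); rewrite mulgA -gmulfM mulgV mulg1.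
  by rewrite -gmulfM mul1g.
move=> P1 Pj1 Pj2.
have P1E g x : P (j1 g * x) = P x.
  by apply/propext; split=> [/(Pj1 g^-1)|/Pj1//]; rewrite mulgA jV mul1g.
have P2E g x : P (j2 g * x) = P x.
  by apply/propext; split=> [/(Pj2 g^-1)|/Pj2//]; rewrite mulgA jV mul1g.
pose X := (G * bool)%type.
pose s (u : X) : X := (u.1, if pselect (P u.1) then ~~ u.2 else u.2).
have sK : involutive s.
  by case=> x b; rewrite /s /=; case: pselect => //= _; rewrite negbK.
pose a (g : G) (u : X) : X := (g * u.1, u.2).
have aA : is_action a.
  by split=> [[x b]|g h [x b]]; rewrite /a /= ?mul1g ?mulgA.
pose b g u := s (a g (s u)).
have bA : is_action b.
  by split=> [u|g h u]; rewrite /b ?aA.1 ?aA.2 ?sK.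
have [h hE] := action_bij aA; have [h' h'E] := action_bij bA.
have sa1 g u : s (a (j1 g) u) = a (j1 g) (s u).
  by rewrite /s /a /= P1E.
have sa2 g u : s (a (j2 g) u) = a (j2 g) (s u).
  by rewrite /s /a /= P2E.
case: am => _ _ e /(_ _ [the {multiplicative _ -> _} of h \o j1]
   [the {multiplicative _ -> _} of h \o j2])[].
  by move=> c /=; have /= -> := e c.
move=> _ /(_ h h') U.
have {U} hh' : h =1 h'.
  by apply: U => g; apply: bij_ext => u /=; rewrite hE h'E /b (sa1, sa2) sK.
(* The swap moves [(1, true)] because [P 1] holds; the two actions can agree there only if it also
   acts at [x]. *)
move=> x; have := h'E x (1, true).
rewrite -hh' hE /b /s /a /= mulg1.
by case: (pselect (P 1)) => // ?; case: (pselect (P x)).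
Qed.

(** The cocycle identity says that [g] sending [(t, x)] to [(a g x * t, j g * x)] is an action on
    [T * G]. The actions of the two factors glue, and [phi g] is the first coordinate of the image
    of [(1, 1)] under [g]. *)
Lemma amalgam_cocycle (T : groupType) (a1 : G1 -> G -> T) (a2 : G2 -> G -> T) :
  (forall g h x, a1 (g * h) x = a1 g (j1 h * x) * a1 h x) ->
  (forall g h x, a2 (g * h) x = a2 g (j2 h * x) * a2 h x) ->
  (forall c x, a1 (f1 c) x = a2 (f2 c) x) ->
  exists phi : G -> T, [/\ phi 1 = 1,
    forall g x, phi (j1 g * x) = a1 g x * phi x
    & forall g x, phi (j2 g * x) = a2 g x * phi x].
Proof.
move=> a1M a2M a12.
have j_1 (G' : groupType) (j : {multiplicative G' -> G}) : j 1 = 1.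
  by apply: (mulgI (j 1)); rewrite -gmulfM !mulg1.
have act (G' : groupType) (j : {multiplicative G' -> G}) (b : G' -> G -> T) :
    (forall g h x, b (g * h) x = b g (j h * x) * b h x) ->
    is_action (fun g (u : T * G) => (b g u.2 * u.1, j g * u.2)).
  move=> bM; split=> [[t x]|g h [t x]] /=; last by rewrite bM gmulfM !mulgA.
  rewrite j_1 mul1g; have : b 1 x = 1; last by move=> ->; rewrite mul1g.
  by apply: (mulgI (b 1 x)); rewrite mulg1 -[in RHS](mulg1 1) bM j_1 mul1g.
have [c x|a [aA aj1 aj2]] := glue_action (act _ _ _ a1M) (act _ _ _ a2M).
  by case: am => _ _ e _; rewrite a12; congr (_, _ * _); apply: e.
have a_2 g : forall u, (a g u).2 = g * u.2.
  pose P g := forall u, (a g u).2 = g * u.2; apply: (amalgam_ind (P := P)).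
  - by move=> u; rewrite aA.1 mul1g.
  - by move=> h x IH u; rewrite aA.2 aj1 /= IH mulgA.
  - by move=> h x IH u; rewrite aA.2 aj2 /= IH mulgA.
have aE g : a g (1, 1) = ((a g (1, 1)).1, g).
  by rewrite [LHS]surjective_pairing a_2 /= mulg1.
exists (fun g => (a g (1, 1)).1); split; first by rewrite aA.1.
- by move=> g x; rewrite aA.2 aj1 /= a_2 mulg1.
- by move=> g x; rewrite aA.2 aj2 /= a_2 mulg1.
Qed.

End Amalgam.

(** * Subgroups acting freely on the edges of the Bass-Serre tree *)

Section DoubleCosets.
Variables (G : groupType) (N : set G).
Hypothesis sN : subgroup N.

(** An element [x] stands for the right coset [A x], and [N] acts on the right. For the edge group
    as [A], the classes are the edges of the quotient by [N] of the Bass-Serre tree; for a vertex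
    group, its vertices. *)
Definition double_coset (A : set G) x y :=
  exists a n, [/\ A a, N n & y = a * x * n].

Lemma double_coset_refl A x : subgroup A -> double_coset A x x.
Proof.
by move=> sA; exists 1, 1; split; [apply: sub1|apply: sub1|gsimp].
Qed.

Lemma double_coset_sym A x y : subgroup A -> double_coset A x y -> double_coset A y x.
Proof.
move=> sA [a [n [Aa Nn ->]]]; exists a^-1, n^-1; split; [exact: subV|exact: subV|].
by gsimp.
Qed.

Lemma double_coset_trans A x y z : subgroup A ->
  double_coset A x y -> double_coset A y z -> double_coset A x z.
Proof.
move=> sA [a [n [Aa Nn ->]]] [b [m [Ab Nm ->]]].
by exists (b * a), (n * m); split; [apply: subM|apply: subM|gsimp].
Qed.

Lemma double_coset_set A x y : subgroup A ->
  double_coset A x y -> double_coset A x = double_coset A y.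
Proof.
move=> sA xy; apply/funext => z; apply/propext; split.
  exact/double_coset_trans/double_coset_sym.
exact: double_coset_trans.
Qed.

Lemma double_coset_ml A x y a : subgroup A -> A a ->
  double_coset A x (a * y) = double_coset A x y.
Proof.
move=> sA Aa; have h : double_coset A y (a * y).
  by exists a, 1; split => //; [apply: sub1|rewrite mulg1].
apply/propext; split=> /double_coset_trans; apply=> //.
exact: double_coset_sym.
Qed.

Lemma double_coset_mr A x y n : subgroup A -> N n ->
  double_coset A x (y * n) = double_coset A x y.
Proof.
move=> sA Nn; have h : double_coset A y (y * n).
  by exists 1, n; split => //; [apply: sub1|rewrite mul1g].
apply/propext; split=> /double_coset_trans; apply=> //.
exact: double_coset_sym.
Qed.
End DoubleCosets.

Section TreeActions.
Variables (G : groupType) (J : bool -> set G) (J0 N : set G).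
Hypotheses (sJ : forall i, subgroup (J i)) (sJ0 : subgroup J0).
Hypotheses (J0J : forall i, J0 `<=` J i) (sN : subgroup N).
(** Generation by the vertex groups and gluing of cocycles are the two facts through which the
    amalgam enters this section. *)
Hypothesis J_ind : forall P : G -> Prop, P 1 ->
  (forall i g x, J i g -> P x -> P (g * x)) -> forall x, P x.
Hypothesis J_cocycle : forall (T : groupType) (a : bool -> G -> G -> T),
  (forall i g h x, J i g -> J i h -> a i (g * h) x = a i g (h * x) * a i h x) ->
  (forall c x, J0 c -> a true c x = a false c x) ->
  exists phi : G -> T,
    phi 1 = 1 /\ forall i g x, J i g -> phi (g * x) = a i g x * phi x.
Hypothesis J0free : forall c x, J0 c -> N (x^-1 * c * x) -> c = 1.

Local Notation edge := (double_coset N J0).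
Local Notation vertex i := (double_coset N (J i)).

(** A path of [n] steps in the quotient graph from the edge of [x] to the base edge; each step
    passes to another edge at a common vertex, of type [i]. *)
Fixpoint reach n x : Prop :=
  if n is m.+1 then exists i g, J i g /\ reach m (g * x) else edge 1 x.

Lemma reach_edge n x c m : J0 c -> N m -> reach n x -> reach n (c * x * m).
Proof.
move=> Jc Nm; elim: n x c Jc => [|n IH] x c Jc /=.
  by rewrite double_coset_mr// double_coset_ml.
move=> [i [g [Jg rg]]]; exists i, (g * c^-1); split.
  by apply: subM => //; apply/(subV (sJ i))/J0J.
have := IH _ 1 (sub1 sJ0) rg; by gsimp.
Qed.

Lemma reach_ex x : exists n, reach n x.
Proof.
pose P x := exists n, reach n x; apply: (J_ind (P := P)).
  by exists 0%N; apply: double_coset_refl.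
move=> i g {}x Jg [n rn]; exists n.+1; exists i, g^-1; split; first exact: subV.
by rewrite mulKg.
Qed.

Lemma distance_ex : exists d : G -> nat,
  (forall x c m, J0 c -> N m -> d (c * x * m) = d x) /\
  (forall x, ~ edge 1 x -> exists i g, J i g /\ (d (g * x)%g < d x)%N).
Proof.
have ex x : exists n, `[< reach n x >].
  by have [n rn] := reach_ex x; exists n; apply/asboolP.
pose d x := ex_minn (ex x).
have dle x n : reach n x -> (d x <= n)%N.
  by rewrite /d; case: ex_minnP => m _ + /asboolP; apply.
have rd x : reach (d x) x by rewrite /d; case: ex_minnP => m /asboolP.
have d_le x c m : J0 c -> N m -> (d (c * x * m)%g <= d x)%N.
  by move=> Jc Nm; apply: dle; apply: reach_edge.
exists d; split=> [x c m Jc Nm|x nx].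
  apply/eqP; rewrite eqn_leq d_le//=.
  have := d_le (c * x * m) _ _ (subV sJ0 Jc) (subV sN Nm); by gsimp.
case E : (d x) (rd x) => [//|n] [i [g [Jg rg]]].
by exists i, g; split => //; rewrite ltnS; apply: dle.
Qed.

Lemma edge_rep_ex : exists e : G -> G,
  [/\ forall x, edge x (e x), forall x y, edge x y -> e x = e y & e 1 = 1].
Proof.
pose S x : set G := [set y | edge x y /\ (edge x 1 -> y = 1)].
exists (fun x => xget 1 (S x)).
have P x : S x (xget 1 (S x)).
  apply: xgetPex; have [x1|nx] := pselect (edge x 1); first by exists 1.
  by exists x; split => //; apply: double_coset_refl.
split=> [x|x y xy|]; first by case: (P x).
  by congr xget; rewrite /S (double_coset_set sN sJ0 xy).
by case: (P 1) => _; apply; apply: double_coset_refl.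
Qed.

(* A spanning tree of the quotient graph: [e] picks an edge in each class, [p i]
   the edge nearest to the base edge at each vertex, and [s] lifts the tree. *)
Lemma spanning_tree_ex : exists (d : G -> nat) (e : G -> G) (p ga : bool -> G -> G)
    (s : G -> G),
  [/\ [/\ forall x, edge x (e x) & forall x y, edge x y -> e x = e y],
      [/\ forall i x, vertex i x (p i x) & forall i x y, vertex i x y -> p i x = p i y],
      [/\ forall i x, J i (ga i x),
          forall i x, N ((p i x)^-1 * (ga i x)^-1 * x),
          forall i c x m, J0 c -> N m -> ga i (c * x * m) = c * ga i x
        & forall i x, ga i (p i x) = 1],
      [/\ forall x, N (x^-1 * s x),
          forall c x m, J0 c -> N m -> s (c * x * m) = c * s x & s 1 = 1]
    & forall x, s (e x) = 1 \/ exists i,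
        s (e x) = ga i (e x) * s (p i x) /\ (d (p i x) < d x)%N].
Proof.
have [d [dE dlt]] := distance_ex.
have [e [e1 e2 e11]] := edge_rep_ex.
have edge_vertex i x y : edge x y -> vertex i x y.
  by case=> c [n [Jc Nn ->]]; exists c, n; split => //; apply: J0J.
have ee x : e (e x) = e x by rewrite -(e2 _ _ (e1 x)).
have de x : d (e x) = d x.
  by have [c [n [Jc Nn ->]]] := e1 x; rewrite dE.
pose S i x : set G :=
  [set y | [/\ vertex i x y, forall z, vertex i x z -> (d y <= d z)%N & e y = y]].
pose p i x := xget 1 (S i x).
have pS i x : S i x (p i x).
  apply: xgetPex.
  have ex : exists n, `[< exists2 y, vertex i x y & d y = n >].
    by exists (d x); apply/asboolP; exists x => //; apply: double_coset_refl.
  case: (ex_minnP ex) => n /asboolP[y xy <-] ymin; exists (e y); split.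
  - exact/(double_coset_trans sN (sJ i) xy)/edge_vertex.
  - by move=> z xz; rewrite de; apply: ymin; apply/asboolP; exists z.
  - exact: ee.
have p1 i x : vertex i x (p i x) by case: (pS i x).
have p2 i x y : vertex i x y -> p i x = p i y.
  by move=> xy; congr xget; rewrite /S (double_coset_set sN (sJ i) xy).
have ep i x : e (p i x) = p i x by case: (pS i x).
have pe i x : p i (e x) = p i x by apply/esym/p2/edge_vertex.
have [cp cpP] : exists cp : G -> G, forall x, J0 (cp x) /\ N ((e x)^-1 * (cp x)^-1 * x).
  suff /choice[cp ?] : forall x, exists c, J0 c /\ N ((e x)^-1 * c^-1 * x) by exists cp.
  move=> x.
  have [c [n [Jc Nn ex]]] := e1 x; exists c^-1; split; first exact: subV.
  by rewrite ex; gsimp; apply: subV.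
(* Freeness of [N] on the edges enters here: the [J0]-component of [x] relative to [e x] is unique,
   which makes [cp], and later [ga] and [s], equivariant under [J0]. *)
have cp_uniq x c : J0 c -> N ((e x)^-1 * c^-1 * x) -> cp x = c.
  move=> Jc Nc; have [Jcp Ncp] := cpP x.
  suff /(congr1 (fun z => c * z)) : c^-1 * cp x = 1 by rewrite mulVKg mulg1.
  apply: (J0free (x := e x)); first by apply: subM => //; apply: subV.
  have := subM sN Nc (subV sN Ncp); by gsimp.
have cpE c x m : J0 c -> N m -> cp (c * x * m) = c * cp x.
  move=> Jc Nm; have [Jcp Ncp] := cpP x.
  apply: cp_uniq; first exact: subM.
  have <- : e x = e (c * x * m) by apply: e2; exists c, m.
  by gsimp; apply: subM => //; move: Ncp; gsimp.
have cp1 x : e x = x -> cp x = 1.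
  by move=> ex; apply: cp_uniq; [apply: sub1|rewrite ex; gsimp; apply: sub1].
have [g0 g0P] : exists g0 : bool * G -> G, forall u, [/\ J u.1 (g0 u),
    N ((p u.1 u.2)^-1 * (g0 u)^-1 * u.2) & u.2 = p u.1 u.2 -> g0 u = 1].
  suff /choice[g0 ?] : forall u : bool * G, exists g, [/\ J u.1 g,
    N ((p u.1 u.2)^-1 * g^-1 * u.2) & u.2 = p u.1 u.2 -> g = 1] by exists g0.
  move=> [i x] /=.
  have [xp|nx] := pselect (x = p i x).
    by exists 1; split => //; [apply: sub1|rewrite -xp; gsimp; apply: sub1].
  have [g [n [Jg Nn pE]]] := p1 i x; exists g^-1; split=> //; first exact: subV.
  by rewrite pE; gsimp; apply: subV.
pose ga i x := cp x * g0 (i, e x).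
have gaJ i x : J i (ga i x).
  apply: subM => //; last by case: (g0P (i, e x)).
  by apply: J0J; case: (cpP x).
have gaN i x : N ((p i x)^-1 * (ga i x)^-1 * x).
  have [_ + _] := g0P (i, e x); have [_] := cpP x => /= Nc; rewrite pe => Ng.
  have := subM sN Ng Nc; rewrite /ga; by gsimp.
have gap i x : ga i (p i x) = 1.
  rewrite /ga cp1 ?ep // mul1g; case: (g0P (i, p i x)) => _ _; apply => /=.
  by apply: p2.
have [par parP] : exists par : G -> bool,
    forall x, e x <> 1 -> (d (p (par x) x) < d x)%N.
  suff /choice[par ?] : forall x, exists i, e x <> 1 -> (d (p i x) < d x)%N.
    by exists par.
  move=> x.
  have [->|ex] := pselect (e x = 1); first by exists true.
  have [|i [g [Jg lt]]] := dlt x; first by move=> /e2; rewrite e11 => /esym.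
  exists i => _; apply: leq_ltn_trans lt; have [_ + _] := pS i x; apply.
  by rewrite double_coset_ml//; apply: double_coset_refl.
(* The product of the [ga] along the tree path from [x] to the base edge. The argument [n] is fuel;
   [d x] steps suffice, since the distance drops at each of them. *)
pose S_ := fix S_ n x := if n is m.+1 then
  if x == 1 then 1 else ga (par x) x * S_ m (p (par x) x) else 1.
have S_1 n : S_ n 1 = 1 by case: n => //= n; rewrite eqxx.
have d0 x : e x = x -> d x = 0%N -> x = 1.
  move=> ex dx; apply: contrapT => nx.
  by have := parP x; rewrite ex dx => /(_ nx).
have S_E n m x : e x = x -> (d x <= n)%N -> (d x <= m)%N -> S_ n x = S_ m x.
  elim: n m x => [|n IH] m x ex.
    by rewrite leqn0 => /eqP /(d0 _ ex) -> _; rewrite S_1.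
  case: m => [|m]; first by rewrite leqn0 => _ /eqP /(d0 _ ex) ->; rewrite S_1.
  move=> xn xm /=; case: eqP => // nx; congr (_ * _).
  have lt := parP x; rewrite ex in lt; move: lt => /(_ nx) lt.
  by apply: IH => //; rewrite -ltnS; apply: leq_trans lt _.
have S_N n x : e x = x -> (d x <= n)%N -> N (x^-1 * S_ n x).
  elim: n x => [|n IH] x ex.
    rewrite leqn0 => /eqP /(d0 _ ex) ->; rewrite S_1; gsimp; exact: sub1.
  move=> xn /=; case: eqP => [->|nx]; first by gsimp; apply: sub1.
  have lt := parP x; rewrite ex in lt; move: lt => /(_ nx) lt.
  have := IH (p (par x) x) (ep _ _) _.
  rewrite -ltnS (leq_trans lt xn) => /(_ isT) Np.
  have := subM sN (subV sN (gaN (par x) x)) Np; by gsimp.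
pose s x := cp x * S_ (d x) (e x).
have sp i x : s (p i x) = S_ (d (p i x)) (p i x).
  by rewrite /s cp1 ?ep // mul1g.
exists d, e, p, ga, s; split => //.
- split=> // i c x m Jc Nm; rewrite /ga cpE// -mulgA; congr (_ * (_ * g0 (_, _))).
  by apply/esym/e2; exists c, m.
- split=> [x|c x m Jc Nm|].
  + have [_ Nc] := cpP x; have := S_N (d x) (e x) (ee x); rewrite de leqnn.
    move=> /(_ isT) NS; have := subM sN (subV sN Nc) NS.
    by rewrite /s; gsimp.
  + rewrite /s cpE// dE// -mulgA; congr (_ * (_ * S_ _ _)).
    by apply/esym/e2; exists c, m.
  + by rewrite /s e11 S_1 cp1// mulg1.
- move=> x; rewrite {1 2}/s ee de cp1 ?ee // mul1g.
  have [->|nx] := pselect (e x = 1); first by left.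
  right; exists (par (e x)).
  have := parP (e x); rewrite ee pe de => /(_ nx) lt; split => //.
  rewrite sp; case: (d x) lt => // n lt /=.
  rewrite (introF eqP nx); congr (_ * _); rewrite pe.
  by apply: S_E; rewrite ?ep.
Qed.

(** * The free product structure read off the spanning tree *)

Section Decomposition.
Variables (e : G -> G) (p ga : bool -> G -> G) (s : G -> G) (d : G -> nat).
Hypotheses (e_edge : forall x, edge x (e x)) (e_eq : forall x y, edge x y -> e x = e y).
Hypotheses (p_vertex : forall i x, vertex i x (p i x))
  (p_eq : forall i x y, vertex i x y -> p i x = p i y).
Hypotheses (gaJ : forall i x, J i (ga i x))
  (gaN : forall i x, N ((p i x)^-1 * (ga i x)^-1 * x))
  (gaE : forall i c x m, J0 c -> N m -> ga i (c * x * m) = c * ga i x)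
  (gap : forall i x, ga i (p i x) = 1).
Hypotheses (sNx : forall x, N (x^-1 * s x))
  (sE : forall c x m, J0 c -> N m -> s (c * x * m) = c * s x) (s1 : s 1 = 1).
Hypothesis s_tree : forall x, s (e x) = 1 \/ exists i,
  s (e x) = ga i (e x) * s (p i x) /\ (d (p i x) < d x)%N.

(** Consider the graph whose nodes are the edges and the vertices of the quotient, joined by
    incidence. Then [t i x] is the element of [N] attached to the incidence of the edge of [x] with
    its vertex of type [i], and it is 1 along the tree; [Nv i q] is the stabilizer in [N] of the
    lifted vertex, and [mu i g x] the part of [g] in it. For [g] in [J i], [(s (g * x))^-1 * g * s x
    = t i (g * x) * mu i g x * (t i x)^-1]. *)
Let t i x := (s x)^-1 * ga i x * s (p i x).
Let Nv i q : set G := [set n | N n /\ J i (s q * n * (s q)^-1)].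
Let mu i g x := (s (p i x))^-1 * (ga i (g * x))^-1 * g * ga i x * s (p i x).

Let edge_vertex i x y : edge x y -> vertex i x y.
Proof. by case=> c [n [Jc Nn ->]]; exists c, n; split => //; apply: J0J. Qed.

Let p_ml i g x : J i g -> p i (g * x) = p i x.
Proof.
by move=> Jg; apply/esym/p_eq; rewrite double_coset_ml//; apply: double_coset_refl.
Qed.

Let p_mr i x n : N n -> p i (x * n) = p i x.
Proof.
by move=> Nn; apply/esym/p_eq; rewrite double_coset_mr//; apply: double_coset_refl.
Qed.

Let pp i x : p i (p i x) = p i x.
Proof. exact/esym/p_eq. Qed.

Let sEr x m : N m -> s (x * m) = s x.
Proof. by move=> Nm; have := @sE 1 x m (sub1 sJ0) Nm; gsimp. Qed.

Let gaEr i x m : N m -> ga i (x * m) = ga i x.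
Proof. by move=> Nm; have := @gaE i 1 x m (sub1 sJ0) Nm; gsimp. Qed.

Let tE i c x m : J0 c -> N m -> t i (c * x * m) = t i x.
Proof.
move=> Jc Nm; rewrite /t gaE// sE// p_mr// p_ml; last exact: J0J.
by gsimp.
Qed.

Let tN i x : N (t i x).
Proof.
have := subM sN (subM sN (subV sN (sNx x)) (subV sN (gaN i x))) (sNx (p i x)).
by rewrite /t; gsimp.
Qed.

Let tp i x : t i (p i x) = 1.
Proof. by rewrite /t gap pp; gsimp. Qed.

Let tEr i x m : N m -> t i (x * m) = t i x.
Proof. by move=> Nm; have := @tE i 1 x m (sub1 sJ0) Nm; gsimp. Qed.

Let gaC i x y : N (x^-1 * y) -> ga i y = ga i x.
Proof. by move=> /(gaEr i x); rewrite mulVKg. Qed.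

Let tC i x y : N (x^-1 * y) -> t i y = t i x.
Proof. by move=> /(tEr i x); rewrite mulVKg. Qed.

Let pC i x y : N (x^-1 * y) -> p i y = p i x.
Proof. by move=> /(p_mr i x); rewrite mulVKg. Qed.

Let muNv i g x : J i g -> Nv i (p i x) (mu i g x).
Proof.
move=> Jg; split; last first.
  rewrite /mu; gsimp; apply: subM => //; apply: subM => //.
  exact: subV.
have gN := gaN i (g * x); rewrite p_ml// in gN.
have := subM sN (subM sN (subV sN (sNx (p i x))) gN) (subM sN (subV sN (gaN i x)) (sNx (p i x))).
by rewrite /mu; gsimp.
Qed.

Let subgroup_Nv i q : subgroup (Nv i q).
Proof.
split=> /=.
- by split; gsimp; apply: sub1.
- move=> x y [Nx Jx] [Ny Jy]; split; first exact: subM.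
  by have := subM (sJ i) Jx Jy; gsimp.
- move=> x [Nx Jx]; split; first exact: subV.
  by have := subV (sJ i) Jx; gsimp.
Qed.

(* The cocycle a is trivial on J0, and phi (s x) = 1 by induction along the tree. *)
Lemma decomposition_hom (T : groupType) (b0 : G -> T) (b : bool -> G -> G -> T) :
  b0 1 = 1 -> (forall i x, hom_on (Nv i (p i x)) (b i (p i x))) ->
  exists phi : G -> T, [/\ hom_on N phi, forall i x, phi (t i x) = b0 (t i x)
    & forall i x n, Nv i (p i x) n -> phi n = b i (p i x) n].
Proof.
move=> b01 bM.
(* The expression of [(s (g * x))^-1 * g * s x] through [t] and [mu], with each factor replaced by
   its prescribed image. *)
pose a i g x := b0 (t i (g * x)) * b i (p i x) (mu i g x) * (b0 (t i x))^-1.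
have aM i g h x : J i g -> J i h -> a i (g * h) x = a i g (h * x) * a i h x.
  move=> Jg Jh; rewrite /a p_ml//; gsimp; congr (_ * _).
  rewrite -!mulgA; congr (_ * _); rewrite -bM; try exact: muNv.
    by congr (b i _ _); rewrite /mu p_ml//; gsimp.
  by rewrite -(@p_ml i h) //; apply: muNv.
have a0 i c x : J0 c -> a i c x = 1.
  move=> Jc; rewrite /a /mu.
  have := @tE i c x 1 Jc (sub1 sN); have := @gaE i c x 1 Jc (sub1 sN).
  rewrite !mulg1 => -> ->; gsimp.
  by rewrite (hom_on1 (subgroup_Nv _ _) (@bM i x)); gsimp.
have [phi [phi1 phiM]] : exists phi : G -> T,
    phi 1 = 1 /\ forall i g x, J i g -> phi (g * x) = a i g x * phi x.
  by apply: J_cocycle => // c x Jc; rewrite !a0.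
have ar i g x n : N n -> a i g (x * n) = a i g x.
  move=> Nn; rewrite /a /mu p_mr// (mulgA g x n).
  by rewrite !(tEr _ _ Nn) !(gaEr _ _ Nn).
have phir x n : N n -> phi (x * n) = phi x * phi n.
  move=> Nn; pose P x := phi (x * n) = phi x * phi n.
  apply: (J_ind (P := P)); first by rewrite /P mul1g phi1 mul1g.
  by move=> i g {}x Jg Px; rewrite /P -mulgA !(phiM _ _ _ Jg) Px ar// mulgA.
have phic c x : J0 c -> phi (c * x) = phi x.
  by move=> Jc; rewrite (phiM true) ?a0 ?mul1g//; apply: J0J.
have aga i x : a i (ga i x) (s (p i x)) = b0 (t i x).
  have gsN : N (x^-1 * (ga i x * s (p i x))).
    by have := subM sN (subV sN (gaN i x)) (sNx (p i x)); gsimp.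
  have Np := sNx (p i x).
  have t1 : t i (s (p i x)) = 1 by rewrite (tC i Np).
  rewrite /a /mu t1 (tC i gsN) (gaC i gsN) (pC i Np) pp (gaC i Np) gap; gsimp.
  by rewrite (hom_on1 (subgroup_Nv _ _) (@bM i x)) b01; gsimp.
have phis x : phi (s x) = 1.
  have [n] := ubnP (d x); elim: n x => // n IH x; rewrite ltnS => xn.
  have -> : phi (s x) = phi (s (e x)).
    by have [c [m [Jc Nm ->]]] := e_edge x; rewrite sE// phic.
  have [->//|[i [se lt]]] := s_tree x; rewrite se.
  have pe : p i x = p i (e x) by apply/p_eq/edge_vertex.
  rewrite (phiM i)// {1}pe aga IH ?mulg1 ?(leq_trans lt)//.
  by rewrite /t se -pe; gsimp.
have phi_sl x n : N n -> phi (s x * n) = phi n.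
  by move=> Nn; rewrite phir// phis mul1g.
exists phi; split.
- by move=> x y _ Ny; apply: phir.
- move=> i x; rewrite -(phi_sl x _ (tN i x)) {1}/t; gsimp.
  by rewrite (phiM i)// aga phis mulg1.
- move=> i x n Nvn; have [Nn Jn] := Nvn; set g := s (p i x) * n * (s (p i x))^-1 in Jn.
  have -> : phi n = phi (g * s (p i x)).
    by rewrite /g mulgVK phi_sl.
  rewrite (phiM i)// phis mulg1 /a.
  have Np := sNx (p i x).
  have Np' : N ((p i x)^-1 * (g * s (p i x))).
    by rewrite /g mulgVK mulgA; apply: subM.
  rewrite /mu (pC i Np) pp (tC i Np) (tC i Np') (gaC i Np) (gaC i Np') gap tp b01.
  by rewrite /g; gsimp.
Qed.

(** By induction on [x], every [(s (x * z))^-1 * x * s z] lies in [S]. For [z = 1] and [x] in [N]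
    this element is [x] itself, because [s] is right [N]-invariant and [s 1 = 1]. *)
Lemma decomposition_generated (S : set G) : subgroup S ->
  (forall i x, S (t i x)) -> (forall i x, Nv i (p i x) `<=` S) -> N `<=` S.
Proof.
move=> sS St Sv.
have gS i g z : J i g -> S ((s (g * z))^-1 * g * s z).
  move=> Jg; have := subM sS (subM sS (St i (g * z)) (Sv i z _ (muNv z Jg))) (subV sS (St i z)).
  by rewrite /t /mu p_ml//; gsimp.
have xS x : forall z, S ((s (x * z))^-1 * x * s z).
  pose P x := forall z, S ((s (x * z))^-1 * x * s z); apply: (J_ind (P := P)).
    by move=> z; gsimp; apply: sub1.
  move=> i g {}x Jg IH z; have := subM sS (gS i g (x * z) Jg) (IH z).
  by gsimp.
by move=> n Nn; have := xS n 1; have := sEr 1 Nn; rewrite mulg1 mul1g s1 => ->; gsimp.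
Qed.

Lemma finite_edge_range (k : nat) (kappa : G -> 'I_k) (U : Type) (f : bool -> G -> U) :
  (forall x y, kappa x = kappa y -> edge x y) ->
  (forall i x y, edge x y -> f i x = f i y) ->
  finite_set [set u | exists i x, u = f i x].
Proof.
move=> kE fE.
pose g (v : bool * 'I_k) := f v.1 (xget 1 [set x | kappa x = v.2]).
apply: (@sub_finite_set _ _ (g @` [set: bool * 'I_k])).
  move=> _ [i [x ->]]; exists (i, kappa x) => //; apply/fE/kE => /=.
  by apply: (@xgetPex _ 1 [set y | kappa y = kappa x]); exists x.
exact: finite_image.
Qed.

Lemma decomposition (k : nat) (kappa : G -> 'I_k) :
  (forall x y, kappa x = kappa y -> edge x y) ->
  exists (k : nat) (F_ : 'I_k.+1 -> set G),
    [/\ free_product N F_, free_group (F_ ord0), finitely_generated (F_ ord0)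
      & forall j : 'I_k.+1, (0 < j)%N ->
          exists i g, F_ j = [set n | N n /\ J i (g * n * g^-1)]].
Proof.
move=> kE.
have fX := finite_edge_range kE (f := t).
have {}fX : finite_set [set u | exists i x, u = t i x].
  by apply: fX => i x y [c [n [Jc Nn ->]]]; rewrite tE.
(* Images are prescribed by a function [b0] of the group element, so incidences with equal [t] need
   not be told apart. Only 1 is removed, since [b0 1 = 1] is imposed. *)
pose X := [set u | exists i x, u = t i x] `\ 1.
have {}fX : finite_set X by apply: finite_setD.
have XN : X `<=` N by move=> _ [[i [x ->]] _].
have tX i x : generated X (t i x).
  have [->|nt] := pselect (t i x = 1); first exact: (sub1 (subgroup_generated X)).
  by apply: sub_generated; split => //; exists i, x.
have [vs vsP] : exists vs, uniq vs /\ forall v, v \in vs <-> exists i x, v = (i, p i x).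
  have /finite_seqP[vs vsE] : finite_set [set v | exists i x, v = (i, p i x)].
    apply: (finite_edge_range kE (f := fun i x => (i, p i x))) => i x y xy.
    by rewrite (p_eq (edge_vertex i xy)).
  exists (undup vs); split=> [|v]; first exact: undup_uniq.
  rewrite mem_undup; split=> h.
    have : [set` vs] v by [].
    by rewrite -vsE.
  by have : [set v | exists i x, v = (i, p i x)] v by []; rewrite vsE.
case: vsP => vs_uniq vsP.
pose v j := nth (true, 1) vs j.
have vp j : (j < size vs)%N -> exists x, (v j).2 = p (v j).1 x.
  by move=> /(mem_nth (true, 1))/vsP[i [x vE]]; exists x; rewrite /v vE.
pose B j := if j is m.+1 then Nv (v m).1 (v m).2 else generated X.
have sB j : subgroup (B j).
  by case: j => [|j]; [apply: subgroup_generated|apply: subgroup_Nv].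
have BN j : B j `<=` N.
  by case: j => [|j] /=; [apply: generated_sub|move=> x []].
exists (size vs), (fun j => B j); split; last 1 first.
- by case=> [[|j] //= lj] _; exists (v j).1, (s (v j).2).
- split=> // T b bM.
  pose b0 := b ord0.
  pose bv i q := b (inord (index (i, q) vs).+1).
  have bvM i x : hom_on (Nv i (p i x)) (bv i (p i x)).
    have vi : (i, p i x) \in vs by apply/vsP; exists i, x.
    have := bM (inord (index (i, p i x) vs).+1).
    rewrite inordK ?ltnS ?index_mem//= /v nth_index//.
  have [|phi [phiM phit phiv]] := decomposition_hom _ bvM (b0 := b0).
    exact: (hom_on1 (sB 0%N) (bM ord0)).
  split.
    exists phi; split=> // -[[|j] lj] x /= Bx.
      rewrite (_ : Ordinal lj = ord0); last exact: val_inj.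
      have sX := @subgroup_generated _ X.
      apply: (hom_on_generated sX _ _ (bM ord0)) Bx; first exact: sub_generated.
        by move=> y z By Bz; apply: phiM; apply: (BN 0%N).
      by move=> _ [[i [y ->]] _]; rewrite phit.
    have [y vy] := vp j lj; rewrite vy in Bx.
    rewrite (phiv _ _ _ Bx) /bv -vy -surjective_pairing index_uniq//.
    by congr (b _ _); apply: val_inj; rewrite /= inordK.
  move=> h h' hM h'M hh'.
  suff NS : N `<=` [set x | N x /\ h x = h' x] by move=> x /NS[].
  have sS := subgroup_eq_on sN hM h'M.
  apply: decomposition_generated => // [i x|i x n Nvn].
    split; first exact: tN.
    apply: (hom_on_generated sN XN hM h'M _ (tX i x)) => y Xy.
    by apply: (hh' ord0); apply: sub_generated.
  have vi : (i, p i x) \in vs by apply/vsP; exists i, x.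
  split; first by case: Nvn.
  apply: (hh' (inord (index (i, p i x) vs).+1)).
  by rewrite inordK ?ltnS ?index_mem//= /v nth_index.
- exists X; split; [exact: subgroup_generated|exact: sub_generated|].
  move=> T b; split; last first.
    move=> h h' hM h'M hh'.
    exact: (hom_on_generated (subgroup_generated X) (@sub_generated _ X) hM h'M hh').
  have [|//|phi [phiM phit _]] := @decomposition_hom T
    (fun z => if z == 1 then 1 else b z) (fun _ _ _ => 1).
  - by rewrite eqxx.
  - by move=> i x y z _ _; rewrite mulg1.
  exists phi; split; first by move=> x y Xx Xy; apply: phiM; apply: (BN 0%N).
  by move=> _ [[i [x ->]] nt]; rewrite phit (introF eqP nt).
- by exists X.
Qed.
End Decomposition.

Theorem free_product_decomposition (k : nat) (kappa : G -> 'I_k) :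
  (forall x y, kappa x = kappa y -> edge x y) ->
  exists (k : nat) (F_ : 'I_k.+1 -> set G),
    [/\ free_product N F_, free_group (F_ ord0), finitely_generated (F_ ord0)
      & forall j : 'I_k.+1, (0 < j)%N ->
          exists i g, F_ j = [set n | N n /\ J i (g * n * g^-1)]].
Proof.
move=> kE; have [d [e [p [ga [s [[? ?] [? ?] [? ? ? ?] [? ? ?] ?]]]]]] := spanning_tree_ex.
by apply: (@decomposition e p ga s d) kE.
Qed.
End TreeActions.

Lemma morph1 (G T : groupType) (f : {multiplicative G -> T}) : f 1 = 1.
Proof. by apply: (mulgI (f 1)); rewrite -gmulfM !mulg1. Qed.

Lemma morphV (G T : groupType) (f : {multiplicative G -> T}) x : f x^-1 = (f x)^-1.
Proof. by apply: (mulgI (f x)); rewrite -gmulfM !mulgV morph1. Qed.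

Lemma subgroup_range (G T : groupType) (f : {multiplicative G -> T}) :
  subgroup (range f).
Proof.
split; first by exists 1 => //; apply: morph1.
  by move=> _ _ [x _ <-] [y _ <-]; exists (x * y) => //; apply: gmulfM.
by move=> _ [x _ <-]; exists x^-1 => //; apply: morphV.
Qed.

Theorem amalgam_decomposition (G0 G1 G2 G : groupType)
    (f1 : {multiplicative G0 -> G1}) (f2 : {multiplicative G0 -> G2})
    (j1 : {multiplicative G1 -> G}) (j2 : {multiplicative G2 -> G})
    (N : set G) (k : nat) (kappa : G -> 'I_k) :
  amalgamated_product f1 f2 j1 j2 -> subgroup N ->
  (forall c x, N (x^-1 * j1 (f1 c) * x) -> j1 (f1 c) = 1) ->
  (forall x y, kappa x = kappa y -> exists c n, N n /\ y = j1 (f1 c) * x * n) ->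
  exists (k : nat) (F_ : 'I_k.+1 -> set G),
    [/\ free_product N F_, free_group (F_ ord0), finitely_generated (F_ ord0)
      & forall j : 'I_k.+1, (0 < j)%N -> exists g,
          F_ j = [set n | N n /\ range j1 (g * n * g^-1)] \/
          F_ j = [set n | N n /\ range j2 (g * n * g^-1)]].
Proof.
move=> am sN Nfree kE.
pose J i := if i then range j1 else range j2.
pose J0 := range (j1 \o f1).
have j12 c : j1 (f1 c) = j2 (f2 c) by case: am => _ _ + _; apply.
have sJ i : subgroup (J i) by case: i; apply: subgroup_range.
have sJ0 : subgroup J0.
  exact: (subgroup_range [the {multiplicative _ -> _} of j1 \o f1]).
have J0J i : J0 `<=` J i.
  by move=> _ [c _ <-]; case: i => /=; [exists (f1 c)|exists (f2 c)].
have J_ind (P : G -> Prop) : P 1 ->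
    (forall i g x, J i g -> P x -> P (g * x)) -> forall x, P x.
  move=> P1 PM; apply: (amalgam_ind am) => // g x.
    by apply: (PM true); exists g.
  by apply: (PM false); exists g.
have J_cocycle (T : groupType) (a : bool -> G -> G -> T) :
    (forall i g h x, J i g -> J i h -> a i (g * h) x = a i g (h * x) * a i h x) ->
    (forall c x, J0 c -> a true c x = a false c x) ->
    exists phi : G -> T,
      phi 1 = 1 /\ forall i g x, J i g -> phi (g * x) = a i g x * phi x.
  move=> aM a0.
  have [g h x|g h x|c x|phi [phi1 phij1 phij2]] := amalgam_cocycle am (T := T)
    (a1 := fun g => a true (j1 g)) (a2 := fun g => a false (j2 g)).
  - by rewrite gmulfM aM//; [exists g|exists h].
  - by rewrite gmulfM aM//; [exists g|exists h].
  - by rewrite -j12; apply: a0; exists c.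
  exists phi; split=> // -[] _ x [g _ <-]; [exact: phij1|exact: phij2].
have [|x y /kE[c [n [Nn ->]]]|m [F_ [? ? ? FJ]]] :=
    @free_product_decomposition G J J0 N sJ sJ0 J0J sN J_ind J_cocycle _ k kappa.
- by move=> _ x [c _ <-]; apply: Nfree.
- by exists (j1 (f1 c)), n; split => //; exists c.
exists m, F_; split=> // j /FJ[i [g ->]]; exists g.
by case: i; [left|right].
Qed.

(** * Finite index *)

Section FiniteIndex.
Variable G : groupType.
Implicit Types (A H K M : set G).

(* Finite index, witnessed by a finite invariant separating the cosets. *)
Definition fidx H A := exists n (kappa : G -> 'I_n),
  forall x y, A x -> A y -> kappa x = kappa y -> H (x^-1 * y).

Lemma fidx_fin (F : finType) (kappa : G -> F) H A :
  (forall x y, A x -> A y -> kappa x = kappa y -> H (x^-1 * y)) -> fidx H A.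
Proof.
move=> kH; exists #|F|, (fun x => enum_rank (kappa x)) => x y Ax Ay.
by move=> /enum_rank_inj; apply: kH.
Qed.

Lemma fidxS H H' A A' : H `<=` H' -> A' `<=` A -> fidx H A -> fidx H' A'.
Proof.
move=> HH' AA' [n [kappa kH]]; exists n, kappa => x y Ax Ay e.
by apply/HH'/kH => //; apply: AA'.
Qed.

Lemma fidxI H H' A : fidx H A -> fidx H' A -> fidx (H `&` H') A.
Proof.
move=> [n [k kH]] [n' [k' kH']]; apply: (fidx_fin (kappa := fun x => (k x, k' x))).
by move=> x y Ax Ay [e e']; split; [apply: kH|apply: kH'].
Qed.

Lemma lcosetE H x y : lcoset x H y = H (x^-1 * y).
Proof.
apply/propext; split=> [[h Hh <-]|Hxy]; first by rewrite mulKg.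
by exists (x^-1 * y) => //; rewrite mulVKg.
Qed.

Lemma lcoset_eq H x y : subgroup H -> H (x^-1 * y) -> lcoset x H = lcoset y H.
Proof.
move=> sH Hxy; apply/funext => z; rewrite !lcosetE.
rewrite (_ : x^-1 * z = (x^-1 * y) * (y^-1 * z)); last by gsimp.
by rewrite subMl.
Qed.

(** The invariant is made exact: it is evaluated on a canonical representative of the coset, and
    only the values attained on [A] are enumerated. *)
Lemma fidx_reps H A : subgroup H -> A 1 -> fidx H A ->
  exists n (kappa : G -> 'I_n) (r : 'I_n -> G),
    [/\ forall i, A (r i), forall i, kappa (r i) = i
      & forall x y, A x -> A y -> (kappa x = kappa y) <-> H (x^-1 * y)].
Proof.
move=> sH A1 [m [k kH]].
pose c x := xget 1 [set y | A y /\ H (x^-1 * y)].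
have cE x y : A x -> A y -> H (x^-1 * y) -> c x = c y.
  move=> Ax Ay Hxy; congr xget; apply/funext => z; apply/propext.
  rewrite /= (_ : x^-1 * z = (x^-1 * y) * (y^-1 * z)); last by gsimp.
  by rewrite subMl.
have cP x : A x -> A (c x) /\ H (x^-1 * c x).
  move=> Ax; apply: (@xgetPex _ 1 [set y | A y /\ H (x^-1 * y)]).
  by exists x; split => //; gsimp; apply: sub1.
pose B := [set i | `[< exists x, A x /\ k (c x) = i >]]%SET.
have inB x : A x -> k (c x) \in B.
  by move=> Ax; rewrite inE; apply/asboolP; exists x.
pose kappa x := enum_rank_in (inB 1 A1) (k (c x)).
have [r rP] : exists r : 'I_#|B| -> G, forall i, A (r i) /\ kappa (r i) = i.
  suff /choice[r ?] : forall i : 'I_#|B|, exists x, A x /\ kappa x = i by exists r.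
  move=> i; have := enum_valP i; rewrite inE => /asboolP[x [Ax kx]].
  by exists x; split=> //; rewrite /kappa kx enum_valK_in.
exists #|B|, kappa, r; split=> [i|i|x y Ax Ay]; [by case: (rP i)..|split].
  move=> /(congr1 enum_val); rewrite !enum_rankK_in; [|by apply: (inB _)..].
  have [[Acx Hx] [Acy Hy]] := (cP x Ax, cP y Ay).
  move=> /(kH _ _ Acx Acy) Hc.
  have := subM sH (subM sH Hx Hc) (subV sH Hy); by gsimp.
by move=> Hxy; rewrite /kappa (cE x y).
Qed.

Lemma finite_index_fidx H A : subgroup H -> A 1 ->
  finite_set (lcosets A H) <-> fidx H A.
Proof.
move=> sH A1; split=> [/finite_seqP[s sE]|fH].
  exists (size s).+1, (fun x => inord (index (lcoset x H) s)) => x y Ax Ay.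
  have [xs ys] : lcoset x H \in s /\ lcoset y H \in s.
    suff h z : A z -> lcoset z H \in s by split; apply: h.
    move=> Az; have : lcosets A H (lcoset z H) by exists z.
    by rewrite sE.
  move=> /(congr1 (@nat_of_ord _)); rewrite !inordK ?ltnS ?index_size//.
  move=> /(congr1 (nth set0 s)); rewrite !nth_index// => e.
  by have := lcosetE H x y; rewrite e lcosetE mulVg => <-; apply: sub1.
have [n [kappa [r [rA rk kP]]]] := fidx_reps sH A1 fH.
apply: (@sub_finite_set _ _ ((fun i => lcoset (r i) H) @` setT)).
  move=> _ [x Ax <-]; exists (kappa x) => //=; apply: lcoset_eq => //.
  by apply/kP.
exact: finite_image.
Qed.

Lemma fidx_trans H K A : A 1 -> subgroup K -> K `<=` A ->
  (forall x y, A x -> A y -> A (x^-1 * y)) ->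
  fidx H K -> fidx K A -> fidx H A.
Proof.
move=> A1 sK KA AV [m [k kH]] /(fidx_reps sK A1)[n [kappa [r [rA rk kP]]]].
apply: (fidx_fin (kappa := fun x => (kappa x, k ((r (kappa x))^-1 * x)))).
move=> x y Ax Ay [ek]; have Kx : K ((r (kappa x))^-1 * x) by apply/kP.
have Ky : K ((r (kappa y))^-1 * y) by apply/kP.
rewrite -ek in Ky *; move=> /(kH _ _ Kx Ky); by gsimp.
Qed.

Lemma fidx_exp H A : subgroup H -> subgroup A -> fidx H A ->
  exists e, forall x, A x -> H (x ^+ e.+1).
Proof.
(* Among the powers of [x] with exponents 0 to [n], two lie in one coset; the difference of their
   exponents is positive and at most [n], hence divides n factorial. *)
move=> sH sA [n [k kH]]; exists (n`!).-1 => x Ax.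
rewrite prednK ?fact_gt0//.
have /injectivePn[i [j]] : ~~ injectiveb (fun i : 'I_n.+1 => k (x ^+ i)).
  apply/negP => /injectiveP /leq_card; by rewrite !card_ord ltnn.
wlog ij : i j / (i < j)%N.
  move=> W nij; have := nij; rewrite -val_eqE neq_ltn => /orP[lt|lt] e.
    exact: (W i j).
  by apply: (W j i); rewrite // eq_sym.
move=> _ /(kH _ _ (subX sA _ Ax) (subX sA _ Ax)).
have -> : x ^- i * x ^+ j = x ^+ (j - i).
  by rewrite -{1}(subnKC (ltnW ij)) expgnDr mulKg.
move=> Hx; have /dvdnP[q ->] : (j - i %| n`!)%N.
  apply: dvdn_fact; rewrite subn_gt0 ij/=.
  by apply: leq_trans (leq_subr _ _) _; rewrite -ltnS.
by rewrite mulnC expgnA; apply: subX.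
Qed.

Definition normal_fidx M := [/\ subgroup M, forall x y, M y -> M (y ^ x) & fidx M setT].

Definition normal_core K := [set x | forall g, K (x ^ g)].

Lemma normal_core_sub K : normal_core K `<=` K.
Proof. by move=> x /(_ 1); rewrite conjg1. Qed.

Lemma normal_fidx_core K : subgroup K -> fidx K setT -> normal_fidx (normal_core K).
Proof.
move=> sK /(fidx_reps sK Logic.I)[n [kappa [r [_ rk kP]]]].
split.
- split=> [g|x y Kx Ky g|x Kx g] /=; first by rewrite conj1g; apply: sub1.
  + by rewrite conjMg; apply: subM.
  + by rewrite conjVg; apply: subV.
- by move=> x y Ky g; rewrite -conjgM.
(* The invariant is the permutation of the cosets of [K] induced by [x]. *)
- apply: (fidx_fin (kappa := fun x => [ffun i => kappa (x * r i)])) => x y _ _ /ffunP e g.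
  have := e (kappa g); rewrite !ffunE => /kP => /(_ Logic.I Logic.I) Kxy.
  have Kg : K ((r (kappa g))^-1 * g) by apply/kP.
  have := subM sK (subM sK (subV sK Kg) Kxy) Kg; rewrite conjgE; by gsimp.
Qed.

Lemma normal_fidxI M M' : normal_fidx M -> normal_fidx M' -> normal_fidx (M `&` M').
Proof.
move=> [sM nM fM] [sM' nM' fM']; split; [exact: subgroupI| |exact: fidxI].
by move=> x y [? ?]; split; [apply: nM|apply: nM'].
Qed.

End FiniteIndex.

Lemma fidx_preimage (G T : groupType) (A : set G) (B H : set T) (f : G -> T) :
  subgroup A -> hom_on A f -> (forall x, A x -> B (f x)) -> fidx H B ->
  fidx [set x | A x /\ H (f x)] A.
Proof.
move=> sA fM AB [n [k kH]]; exists n, (k \o f) => x y Ax Ay e; split.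
  by apply: subM => //; apply: subV.
rewrite fM ?(hom_onV sA)//; last exact: subV.
by apply: kH => //; apply: AB.
Qed.

(** * Subgroups as group types, abelian subgroups as additive groups *)

Record sub_elt (G : Type) (H : set G) := SubElt { sub_val : G; sub_valP : H sub_val }.
HB.instance Definition _ G (H : set G) := gen_eqMixin (sub_elt H).
HB.instance Definition _ G (H : set G) := gen_choiceMixin (sub_elt H).

Lemma sub_val_inj (G : Type) (H : set G) : injective (@sub_val G H).
Proof.
by move=> [x Hx] [y Hy] /= e; subst y; congr SubElt; apply: Prop_irrelevance.
Qed.

Section SubGroupType.
Variables (G : groupType) (H : set G) (sH : subgroup H).
(** Indexing the type by the proof that [H] is a subgroup lets the group structure, which depends on
    that proof, be attached as an instance. *)
Definition subgroup_type of subgroup H := sub_elt H.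
Local Notation S := (subgroup_type sH).
HB.instance Definition _ := Choice.on S.
Implicit Types u v w : S.
Let one : S := SubElt (sub1 sH).
Let mul u v : S := SubElt (subM sH (sub_valP u) (sub_valP v)).
Let inv u : S := SubElt (subV sH (sub_valP u)).
Let mulA : associative mul.
Proof. by move=> u v w; apply: sub_val_inj; rewrite /= mulgA. Qed.
Let mul1 : left_id one mul.
Proof. by move=> u; apply: sub_val_inj; rewrite /= mul1g. Qed.
Let mulr1 : right_id one mul.
Proof. by move=> u; apply: sub_val_inj; rewrite /= mulg1. Qed.
Let mulV : left_inverse one inv mul.
Proof. by move=> u; apply: sub_val_inj; rewrite /= mulVg. Qed.
Let mulrV : right_inverse one inv mul.
Proof. by move=> u; apply: sub_val_inj; rewrite /= mulgV. Qed.
HB.instance Definition _ := isGroup.Build S mulA mul1 mulr1 mulV mulrV.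

Lemma subgroup_groupType : exists (P : groupType) (i : P -> G),
  [/\ injective i, {morph i : x y / x * y} & range i = H].
Proof.
exists S, (@sub_val G H); split=> //; first exact: sub_val_inj.
by apply/seteqP; split=> [_ [u _ <-]|x Hx]; [apply: sub_valP|exists (SubElt Hx)].
Qed.
End SubGroupType.

Section SubZmodType.
Variables (G : groupType) (H : set G) (aH : abelian_subgroup H).
Let sH : subgroup H := aH.1.
Definition subzmod_type of abelian_subgroup H := sub_elt H.
Local Notation S := (subzmod_type aH).
HB.instance Definition _ := Choice.on S.
Implicit Types u v w : S.
Let zero : S := SubElt (sub1 sH).
Let add u v : S := SubElt (subM sH (sub_valP u) (sub_valP v)).
Let opp u : S := SubElt (subV sH (sub_valP u)).
Let addA : associative add.
Proof. by move=> u v w; apply: sub_val_inj; rewrite /= mulgA. Qed.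
Let addC : commutative add.
Proof. by move=> u v; apply: sub_val_inj; apply: aH.2; apply: sub_valP. Qed.
Let add0 : left_id zero add.
Proof. by move=> u; apply: sub_val_inj; rewrite /= mul1g. Qed.
Let addN : left_inverse zero opp add.
Proof. by move=> u; apply: sub_val_inj; rewrite /= mulVg. Qed.
HB.instance Definition _ := GRing.isZmodule.Build S addA addC add0 addN.

Lemma abelian_zmodType : exists (V : zmodType) (i : V -> G),
  [/\ injective i, {morph i : x y / (x + y)%R >-> x * y} & range i = H].
Proof.
exists S, (@sub_val G H); split=> //; first exact: sub_val_inj.
by apply/seteqP; split=> [_ [u _ <-]|x Hx]; [apply: sub_valP|exists (SubElt Hx)].
Qed.
End SubZmodType.

(** * Finitely generated abelian groups *)

Lemma int_residue m : exists kappa : int -> 'I_m.+1,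
  forall a b, kappa a = kappa b -> (m.+1%:Z %| (b - a)%R)%Z.
Proof.
exists (fun a => inord `|(a %% m.+1)%Z|) => a b /(congr1 (@nat_of_ord _)).
have ml z : (`|(z %% m.+1)%Z| < m.+1)%N.
  by rewrite -ltz_nat gez0_abs ?modz_ge0// ltz_pmod.
rewrite !inordK// => /(congr1 Posz); rewrite !gez0_abs ?modz_ge0// => e.
by rewrite -eqz_mod_dvd e.
Qed.

Section Span.
Variable V : zmodType.
Local Open Scope ring_scope.
Import GRing.Theory Num.Theory.
Implicit Types (v w z : V) (zs : seq V).

Lemma subrBB v w x y : (v - w) - (x - y) = (v - x) - (w - y).
Proof. by rewrite !opprB addrACA [RHS]addrACA [- x - w]addrC. Qed.

Fixpoint span zs v : Prop :=
  if zs is z :: zs' then exists a : int, span zs' (v - z *~ a) else v = 0.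

(** Linear independence over Z in triangular form. *)
Fixpoint indep zs : Prop :=
  if zs is z :: zs' then indep zs' /\ forall a : int, span zs' (z *~ a) -> a = 0
  else True.

Lemma span0 zs : span zs 0.
Proof. by elim: zs => //= z zs IH; exists 0; rewrite mulr0z subr0. Qed.

Lemma spanB zs v w : span zs v -> span zs w -> span zs (v - w).
Proof.
elim: zs v w => /= [|z zs IH] v w; first by move=> -> ->; rewrite subr0.
move=> [a va] [b wb]; exists (a - b); have := IH _ _ va wb.
by rewrite mulrzBr subrBB.
Qed.

Lemma spanN zs v : span zs v -> span zs (- v).
Proof. by move=> /(spanB (span0 zs)); rewrite sub0r. Qed.

Lemma spanD zs v w : span zs v -> span zs w -> span zs (v + w).
Proof. by move=> sv /spanN /(spanB sv); rewrite opprK. Qed.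

Lemma spanMz zs v (a : int) : span zs v -> span zs (v *~ a).
Proof.
move=> sv; have sn n : span zs (v *+ n).
  by elim: n => [|n IH]; [rewrite mulr0n; apply: span0|rewrite mulrS; apply: spanD].
by case: a => n; [rewrite -pmulrn|rewrite NegzE mulrNz -pmulrn; apply: spanN].
Qed.

Lemma span_cons z zs v : span zs v -> span (z :: zs) v.
Proof. by move=> sv; exists 0; rewrite mulr0z subr0. Qed.

Lemma span_head z zs : span (z :: zs) z.
Proof. by exists 1; rewrite mulr1z subrr; apply: span0. Qed.

Lemma indep_torsion_free zs v n : indep zs -> span zs v -> v *+ n.+1 = 0 -> v = 0.
Proof.
elim: zs v => //= z zs IH v [iz hz] [a va] vn.
have /hz : span zs (z *~ (a * n.+1)).
  have := spanMz (- n.+1%:Z) va.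
  by rewrite mulrzBl mulrNz -pmulrn vn oppr0 sub0r -mulrzA mulrN mulrNz opprK.
move/eqP; rewrite mulf_eq0 orbF => /eqP a0.
by apply: IH => //; move: va; rewrite a0 mulr0z subr0.
Qed.

(** Stands in for the structure theorem. A generator [y] with no nonzero multiple in the span found
    so far is added to the family; otherwise some [y *~ a] lies in that span, and the exponent
    [D.+1] is multiplied by the absolute value of [a]. *)
Lemma span_independent ys : exists zs D,
  [/\ indep zs, forall v, span zs v -> span ys v
    & forall v, span ys v -> span zs (v *+ D.+1)].
Proof.
elim: ys => [|y ys [zs [D [iz zy yz]]]].
  by exists [::], 0%N; split => //= v ->; rewrite mul0rn.
have [[a [a0 sa]]|na] := pselect (exists a : int, a <> 0 /\ span zs (y *~ a)); last first.
  exists (y :: zs), D; split=> //=.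
  - by split=> // a sa; apply: contrapT => a0; apply: na; exists a.
  - by move=> v [a va]; exists a; apply: zy.
  - move=> v [a /yz va]; exists (a * D.+1).
    by move: va; rewrite mulrnBl mulrzA -pmulrn.
exists zs, (`|a| * D.+1).-1%N; split=> //.
  by move=> v /zy; apply: span_cons.
move=> v [b /yz vb]; rewrite prednK ?muln_gt0 ?andbT ?absz_gt0; last exact/eqP.
have sa' : span zs (y *+ `|a|%N).
  case: (a) sa => m sa //=.
  by have := spanN sa; rewrite NegzE mulrNz opprK.
pose m : int := `|a|%N; pose e : int := D.+1.
have := spanD (spanMz m vb) (spanMz (b * e) sa').
congr span; rewrite !pmulrn PoszM -/m -/e -!mulrzA mulrzBl -mulrzA.
by rewrite mulrA [m * (b * e)]mulrC subrK mulrC.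
Qed.

(** The invariant records the residues modulo [n.+1] of the coefficients of one chosen expression of
    [v]. *)
Lemma span_mod ys n : exists k (kappa : V -> 'I_k), forall v w,
  span ys v -> span ys w -> kappa v = kappa w ->
  exists2 u, span ys u & w - v = u *+ n.+1.
Proof.
elim: ys => [|y ys [k [kappa kP]]].
  by exists 1%N, (fun=> ord0) => v w /= -> -> _; exists 0 => //; rewrite subr0 mul0rn.
have [c cP] : exists c : V -> int, forall v, span (y :: ys) v -> span ys (v - y *~ c v).
  suff /choice[c ?] : forall v, exists a : int, span (y :: ys) v -> span ys (v - y *~ a).
    by exists c.
  move=> v; have [[a va]|nv] := pselect (span (y :: ys) v); first by exists a.
  by exists 0.
have [res resP] := int_residue n.
pose kap v := (res (c v), kappa (v - y *~ c v)).
exists #|{: 'I_n.+1 * 'I_k}|, (fun v => enum_rank (kap v)) => v w sv sw.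
move=> /enum_rank_inj [/resP /dvdzP[q qE]].
move=> /(kP _ _ (cP _ sv) (cP _ sw))[u su uE].
exists (u + y *~ q); first by exists q; rewrite addrK.
rewrite mulrnDl -uE [in RHS]pmulrn -mulrzA -qE mulrzBr.
by rewrite subrBB subrK.
Qed.
End Span.

Section ZmodMorphism.
Variables (V : zmodType) (G : groupType) (i : V -> G).
Hypothesis iD : {morph i : x y / (x + y)%R >-> x * y}.

Lemma zmorph0 : i 0%R = 1.
Proof. by apply: (mulgI (i 0%R)); rewrite -iD GRing.addr0 mulg1. Qed.

Lemma zmorphN v : i (- v)%R = (i v)^-1.
Proof. by apply: (mulgI (i v)); rewrite -iD GRing.subrr mulgV zmorph0. Qed.

Lemma zmorphMn v n : i (v *+ n)%R = i v ^+ n.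
Proof.
elim: n => [|n IH]; first exact: zmorph0.
by rewrite GRing.mulrS iD IH expgS.
Qed.
End ZmodMorphism.

Section AdditiveOn.
Variables (G : groupType) (V : zmodType) (K : set G) (F : G -> V).
Hypotheses (sK : subgroup K) (FM : forall x y, K x -> K y -> F (x * y) = (F x + F y)%R).

Lemma additive_on1 : F 1 = 0%R.
Proof.
by apply: (GRing.addrI (F 1)); rewrite -FM ?mulg1 ?GRing.addr0//; apply: (sub1 sK).
Qed.

Lemma additive_onV x : K x -> F x^-1 = (- F x)%R.
Proof.
move=> Kx; apply: (GRing.addrI (F x)).
by rewrite -FM ?mulgV ?GRing.subrr ?additive_on1//; apply: (subV sK).
Qed.

Lemma additive_onJ x y : K x -> K y -> F (y^-1 * x * y) = F x.
Proof.
move=> Kx Ky; have Ky' := subV sK Ky.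
rewrite !FM ?additive_onV//; last exact: (subM sK).
by rewrite GRing.addrAC GRing.addNr GRing.add0r.
Qed.

Lemma subgroup_additive_ker : subgroup [set x | K x /\ F x = 0%R].
Proof.
split.
- by split; [apply: (sub1 sK)|apply: additive_on1].
- by move=> u v [Ku u0] [Kv v0]; split; [apply: (subM sK)|rewrite FM// u0 v0 GRing.addr0].
- by move=> u [Ku u0]; split; [apply: (subV sK)|rewrite additive_onV// u0 GRing.oppr0].
Qed.
End AdditiveOn.

(* The properties of finitely generated free abelian groups that matter here. *)
Definition lattice (G : groupType) (L : set G) :=
  [/\ abelian_subgroup L, forall x n, L x -> x ^+ n.+1 = 1 -> x = 1
    & forall n, fidx [set x ^+ n.+1 | x in L] L].

Lemma abelian_subgroupS (G : groupType) (H L : set G) :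
  subgroup H -> H `<=` L -> abelian_subgroup L -> abelian_subgroup H.
Proof. by move=> sH HL [sL cL]; split=> // x y /HL Lx /HL; apply: cL. Qed.

Lemma lattice_sub (G : groupType) (H L : set G) :
  lattice L -> subgroup H -> H `<=` L -> fidx H L -> lattice H.
Proof.
move=> [aL tL fL] sH HL fHL; split; first exact: abelian_subgroupS aL.
  by move=> x n /HL; apply: tL.
move=> n; have [e eH] := fidx_exp sH aL.1 fHL.
apply: fidxS HL (fL (e.+1 * n.+1).-1) => _ [x Lx <-].
by exists (x ^+ e.+1); [apply: eH|rewrite -expgnA].
Qed.

(** Schreier's lemma, with [w h i] the Schreier generators. The representative [r i0] of [B] itself
    need not be 1 and is therefore added to the generators. *)
Lemma finitely_generated_fidx (G : groupType) (H B : set G) :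
  subgroup B -> B `<=` H -> fidx B H -> subgroup H ->
  finitely_generated H -> finitely_generated B.
Proof.
move=> sB BH fBH sH [X [fX HX]].
have [n [kappa [r [rH rk kP]]]] := fidx_reps sB (sub1 sH) fBH.
have XH x : X x -> H x by move=> Xx; rewrite HX; apply: sub_generated.
pose w h i := (r (kappa (h * r i)))^-1 * h * r i.
pose i0 := kappa 1.
have B0 : B (r i0).
  by have := (kP 1 (r i0) (sub1 sH) (rH i0)).1; rewrite rk invg1 mul1g; apply.
pose Y := r i0 |` [set w x i | x in X & i in setT].
have wB h i : H h -> B (w h i).
  by move=> Hh; rewrite /w -mulgA; apply/kP; [|apply: subM|rewrite rk].
have YB : Y `<=` B.
  by move=> _ [->//|[x Xx [i _ <-]]]; apply: wB; apply: XH.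
exists Y; split.
  rewrite finite_setU; split; first exact: finite_set1.
  exact: finite_image2.
apply/seteqP; split; last exact: generated_sub.
have sY := @subgroup_generated _ Y.
have Hw : H `<=` [set h | H h /\ forall i, generated Y (w h i)].
  rewrite {1}HX; apply: generated_sub.
    split => /=.
    - split=> [|i]; first exact: sub1.
      by rewrite /w mul1g rk; gsimp; apply: sub1.
    - move=> h h' [Hh wh] [Hh' wh']; split=> [|i]; first exact: subM.
      have := subM sY (wh (kappa (h' * r i))) (wh' i); rewrite /w.
      suff -> : kappa (h * r (kappa (h' * r i))) = kappa (h * h' * r i) by gsimp.
      apply/kP; try by do ?apply: subM.
      have := wB h' i Hh'; rewrite /w; by gsimp.
    - move=> h [Hh wh]; split=> [|i]; first exact: subV.
      have := subV sY (wh (kappa (h^-1 * r i))); rewrite /w.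
      suff -> : kappa (h * r (kappa (h^-1 * r i))) = i by gsimp.
      rewrite -[RHS]rk; apply/kP; [exact: (subM sH)|exact: rH|].
      by have := wB h^-1 i (subV sH Hh); rewrite /w; gsimp.
  move=> x Xx; split=> [|i]; first exact: XH.
  by apply: sub_generated; right; exists x => //; exists i.
move=> h Bh; have [_ /(_ i0)] := Hw h (BH _ Bh); rewrite /w.
have -> : kappa (h * r i0) = i0.
  apply/kP; [by apply: subM => //; apply: BH|exact: (sub1 sH)|].
  by rewrite mulg1; apply: subV => //; apply: subM.
have g0 : generated Y (r i0) by apply: sub_generated; left.
by rewrite (subMr sY)// (subMl sY)//; apply: (subV sY).
Qed.

(** The abelian subgroup [B] is finitely generated by Schreier's lemma; [L] is the span of an
    independent family in it and contains the [D.+1]-th powers of [B], so it has finite index. *)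
Lemma virtually_abelian_lattice (G : groupType) (H : set G) :
  subgroup H -> finitely_generated H -> virtually_abelian H ->
  exists L, [/\ lattice L, L `<=` H & fidx L H].
Proof.
move=> sH gH [B [[sB BH fB] aB]].
have {}fB : fidx B H by apply/(finite_index_fidx sB (sub1 sH)).
have [Y [/finite_seqP[ys YE] BY]] := finitely_generated_fidx sB BH fB sH gH.
have [V [i [i_inj iD iB]]] := abelian_zmodType aB.
have iP v : B (i v) by rewrite -iB; exists v.
have [g] := right_inverse_on_range (0%R : V) i; rewrite iB => gK.
pose vs := map g ys.
have spanV v : span vs v.
  suff : B `<=` [set x | exists2 v, span vs v & x = i v].
    by move=> /(_ _ (iP v)) [u su /i_inj ->].
  rewrite BY; apply: generated_sub.
    split=> /=.
    - by exists 0%R; [apply: span0|rewrite zmorph0].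
    - by move=> _ _ [u su ->] [u' su' ->]; exists (u + u')%R; [apply: spanD|rewrite iD].
    - by move=> _ [u su ->]; exists (- u)%R; [apply: spanN|rewrite zmorphN].
  move=> y; rewrite YE /= => yy; exists (g y).
    rewrite /vs; elim: (ys) yy => //= z zs IH; rewrite inE => /orP[/eqP ->|/IH].
      exact: span_head.
    exact: span_cons.
  by rewrite gK// BY; apply: sub_generated; rewrite YE.
have [zs [D [iz _ zD]]] := span_independent vs.
pose L := [set i v | v in [set v | span zs v]].
have sL : subgroup L.
  split.
  - by exists 0%R; [apply: span0|rewrite zmorph0].
  - move=> _ _ [u su <-] [u' su' <-]; exists (u + u')%R; [exact: spanD|exact: iD].
  - move=> _ [u su <-]; exists (- u)%R; [exact: spanN|exact: zmorphN].
have LB : L `<=` B by move=> _ [v _ <-].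
exists L; split; last 2 first.
- by move=> x /LB /BH.
- apply: (fidx_trans (sub1 sH) sB BH) fB.
    by move=> x y Hx Hy; apply: subM => //; apply: subV.
  have [k [kappa kP]] := span_mod vs D.
  exists k, (kappa \o g) => x y Bx By /= /(kP _ _ (spanV _) (spanV _))[u _ uE].
  exists (u *+ D.+1)%R; first exact: zD.
  by rewrite -uE iD zmorphN// !gK//; apply: aB.2 => //; apply: subV.
split; first exact: abelian_subgroupS aB.
  move=> _ n [v sv <-]; rewrite -zmorphMn// -(zmorph0 iD) => /i_inj.
  by move=> /(indep_torsion_free iz sv) ->.
move=> n; have [k [kappa kP]] := span_mod zs n.
exists k, (kappa \o g).
have gi v : g (i v) = v by apply: i_inj; rewrite gK.
move=> _ _ [v sv <-] [w sw <-] /=; rewrite !gi => /(kP _ _ sv sw)[u su uE].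
exists (i u); first by exists u.
by rewrite -zmorphMn// -uE GRing.addrC iD zmorphN.
Qed.

(** * Virtual retracts and averaging *)

(* A weak form of virtual retraction that, unlike the latter, is easily glued
   along amalgams: r only has to be a power map on H. *)
Definition power_retraction (G : groupType) (H L K : set G) (r : G -> G) d :=
  [/\ normal_fidx K, hom_on K r, forall x, K x -> L (r x), H `&` K `<=` L
    & forall x, H x -> K x -> r x = x ^+ d.+1].

(** The retraction itself serves, restricted to the normal core of the preimage of [L]. *)
Lemma virtual_retract_power (G : groupType) (H L : set G) :
  subgroup H -> virtual_retract H -> subgroup L -> L `<=` H -> fidx L H ->
  exists K r, power_retraction H L K r 0.
Proof.
move=> sH [K [r [[sK _ fK] HK rM rH rid]]] sL LH fL.
have {}fK : fidx K setT by apply/finite_index_fidx.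
have sK1 := subgroup_ker_on sK rM sL.
have fK1 : fidx [set x | K x /\ L (r x)] setT.
  apply: (fidx_trans _ sK) fK => //.
  exact: (@fidx_preimage _ _ K H).
have MK := @normal_core_sub _ [set x | K x /\ L (r x)].
exists (normal_core [set x | K x /\ L (r x)]), r; split => //.
- exact: normal_fidx_core.
- by move=> x y /MK[Kx _] /MK[Ky _]; apply: rM.
- by move=> x /MK[].
- by move=> x [Hx /MK[_]]; rewrite rid.
- by move=> x Hx _; rewrite rid.
Qed.

(* Averaging r over H / (H `&` K) makes it H-equivariant, so that its kernel M is
   normalized by H, meets H trivially and has M H of finite index. *)
Lemma power_virtual_retract (G : groupType) (H L K : set G) (r : G -> G) d :
  subgroup H -> lattice L -> L `<=` H -> power_retraction H L K r d ->
  virtual_retract H.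
Proof.
move=> sH lL LH [[sK nK fK] rM rL HKL rd].
have [[sL cL] _ _] := lL.
pose A := H `&` K.
have sA : subgroup A by apply: subgroupI.
have fA B : subgroup B -> B `<=` H -> fidx A B.
  case: fK => n [k kP] sB BH; exists n, k => x y Bx By exy; split; last exact: kP.
  by apply: BH; apply: (subM sB) => //; apply: (subV sB).
have lA := lattice_sub lL sA HKL (fA _ sL LH).
have [aA tA fpA] := lA; have cA := aA.2.
have [V [i [i_inj iD iA]]] := abelian_zmodType aA.
have iP v : A (i v) by rewrite -iA; exists v.
have [g] := right_inverse_on_range (0%R : V) i; rewrite iA => gK.
have [e eK] := fidx_exp sK (subgroupT G) fK.
(* The power moves the values from [L] into [A], on which the action of [H] by conjugation is
   available. *)
pose q x := r x ^+ e.+1.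
have qA x : K x -> A (q x).
  by move=> Kx; split; [apply: subX => //; apply/LH/rL|apply: eK].
have qM x y : K x -> K y -> q (x * y) = q x * q y.
  by move=> Kx Ky; rewrite /q rM// expgMn//; apply: cL; apply: rL.
have qV x : K x -> q x^-1 = (q x)^-1.
  by move=> Kx; rewrite /q (hom_onV sK rM Kx) expVgn.
have KJ h x : K x -> K (h^-1 * x * h).
  by move=> /(nK h); rewrite conjgE mulgA.
have KJV h x : K x -> K (h * x * h^-1).
  by move=> /(KJ h^-1); rewrite invgK.
have AJV h x : H h -> A x -> A (h * x * h^-1).
  move=> Hh [Hx Kx]; split; last exact: KJV.
  by apply: subM => //; [apply: subM|apply: subV].
pose ac h v := g (h * i v * h^-1).
have iac h v : H h -> i (ac h v) = h * i v * h^-1.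
  by move=> Hh; rewrite /ac gK//; apply: AJV.
have acD h : H h -> {morph ac h : v w / (v + w)%R}.
  by move=> Hh v w; apply: i_inj; rewrite iD !iac// iD; gsimp.
have ac0 h : H h -> ac h 0%R = 0%R.
  by move=> Hh; apply: i_inj; rewrite iac// (zmorph0 iD); gsimp.
(* The conjugate of [q] by [h], written additively. It depends only on the coset of [h] modulo [A],
   because [A] is commutative and contains the values of [q]. *)
pose F h k := ac h (g (q (h^-1 * k * h))).
have iF h k : H h -> K k -> i (F h k) = h * q (h^-1 * k * h) * h^-1.
  by move=> Hh Kk; rewrite iac// gK//; apply: qA; apply: KJ.
have F_coset h l k : H h -> A l -> K k -> F (h * l) k = F h k.
  move=> Hh Al Kk; have [Hl Kl] := Al; apply: i_inj; rewrite !iF//; last exact: subM.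
  have Kk' := KJ h k Kk.
  have -> : (h * l)^-1 * k * (h * l) = l^-1 * (h^-1 * k * h) * l by gsimp.
  have Kl' := subV sK Kl.
  have ql z : K z -> q (l^-1 * z * l) = q z.
    move=> Kz; rewrite !qM ?qV//; last exact: subM.
    by rewrite -mulgA -(cA (q l)) ?mulKg//; apply: qA.
  rewrite ql//.
  have lq : l * q (h^-1 * k * h) * l^-1 = q (h^-1 * k * h).
    by rewrite (cA l _ Al (qA _ Kk')) mulgK.
  by rewrite -[in RHS]lq; gsimp.
have [n [kappa [s [sH' sk kP]]]] := fidx_reps sA (sub1 sH) (fA _ sH (fun=> id)).
pose R k : V := (\sum_(j < n) F (s j) k)%R.
have F_kappa h k : H h -> K k -> F (s (kappa h)) k = F h k.
  move=> Hh Kk; rewrite -(F_coset _ ((s (kappa h))^-1 * h)) ?mulVKg//.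
  by apply/kP.
have F_conj h h' k : H h -> H h' -> K k -> F h' (h * k * h^-1) = ac h (F (h^-1 * h') k).
  move=> Hh Hh' Kk; apply: i_inj; rewrite iac// !iF//; last first.
    - exact: KJV.
    - by apply: subM => //; apply: subV.
  by gsimp.
have R_conj h k : H h -> K k -> R (h * k * h^-1) = ac h (R k).
  move=> Hh Kk; rewrite /R (big_morph (ac h) (acD h Hh) (ac0 h Hh)).
  pose sg j := kappa (h^-1 * s j).
  have sg_inj : injective sg.
    have Hs j : H (h^-1 * s j) by apply: subM => //; apply: subV.
    move=> j j' /(kP _ _ (Hs j) (Hs j')); gsimp => Ajj'.
    by rewrite -(sk j) -(sk j'); apply/kP.
  rewrite [RHS](reindex_inj sg_inj); apply: eq_bigr => j _.
  rewrite F_conj// F_kappa//; apply: subM => //; exact: subV.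
have R_M x y : K x -> K y -> R (x * y) = (R x + R y)%R.
  move=> Kx Ky; rewrite /R -big_split; apply: eq_bigr => j _ /=.
  rewrite /F -acD//; congr ac; apply: i_inj.
  rewrite iD !gK; try by apply: qA; do ?apply: KJ => //; apply: subM.
  by rewrite -qM; try exact: KJ; congr q; gsimp.
(* On [A] each of the [n] summands of [R] is multiplication by [D], so [R] is multiplication by
   [n * D] there. *)
pose D := (d.+1 * e.+1)%N.
have R_A v : R (i v) = (v *+ (n * D))%R.
  rewrite /R (eq_bigr (fun=> v *+ D)%R) ?GRing.sumr_const ?card_ord.
    by rewrite -GRing.mulrnA mulnC.
  move=> j _; have [Hv Kv] := iP v; apply: i_inj; rewrite iF// (zmorphMn iD).
  have Hs := sH' j; rewrite /q rd; last exact: KJ; last first.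
    by apply: subM => //; apply: subM => //; apply: subV.
  rewrite -expgnA -/D; have -> : (s j)^-1 * i v * s j = i v ^ s j by rewrite conjgE mulgA.
  by rewrite -conjXg conjgE; gsimp.
have n_gt0 : (0 < n)%N by case: (kappa 1) => m; apply: leq_ltn_trans.
have nD_gt0 : (0 < n * D)%N by rewrite muln_gt0 n_gt0.
pose M := [set k | K k /\ R k = 0%R].
have sM : subgroup M by apply: subgroup_additive_ker.
have MJ h m : H h -> M m -> M (h * m * h^-1).
  by move=> Hh [Km Rm]; split; [apply: KJV|rewrite R_conj// Rm ac0].
have MH x : M x -> H x -> x = 1.
  move=> [Kx Rx] Hx; have Ax : A x by [].
  move: Rx; rewrite -(gK x Ax) R_A => /(congr1 i).
  rewrite (zmorphMn iD) (zmorph0 iD) -(prednK nD_gt0).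
  by apply: tA; apply: iP.
pose P := [set x | exists m h, [/\ M m, H h & x = m * h]].
have P_uniq m h m' h' : M m -> H h -> M m' -> H h' -> m * h = m' * h' -> h = h'.
  move=> Mm Hh Mm' Hh' emh; apply: divg1_eq; apply: MH; last first.
    by apply: subM => //; apply: subV.
  have -> : h * h'^-1 = m^-1 * m' by rewrite -[h](mulKg m) emh; gsimp.
  by apply: subM => //; apply: subV.
have [ret retP] : exists ret : G -> G, forall m h, M m -> H h -> ret (m * h) = h.
  suff /choice[ret rP] : forall x, exists h', forall m h, M m -> H h -> x = m * h -> h' = h.
    by exists ret => m h Mm Hh; apply: rP erefl.
  move=> x; have [[m [h [Mm Hh ->]]]|nP] := pselect (P x).
    by exists h => m' h' Mm' Hh'; apply: P_uniq.
  by exists 1 => m h Mm Hh xE; case: nP; exists m, h.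
have PM (m h m' h' : G) : m * h * (m' * h') = (m * (h * m' * h^-1)) * (h * h') by gsimp.
have sP : subgroup P.
  split.
  - by exists 1, 1; split; [exact: (sub1 sM)|exact: (sub1 sH)|rewrite mulg1].
  - move=> _ _ [m [h [Mm Hh ->]]] [m' [h' [Mm' Hh' ->]]]; rewrite PM.
    exists (m * (h * m' * h^-1)), (h * h').
    by split; [apply: (subM sM) => //; apply: MJ|apply: (subM sH)|].
  - move=> _ [m [h [Mm Hh ->]]]; exists (h^-1 * m^-1 * h^-1^-1), h^-1.
    split; [apply: MJ; [exact: (subV sH)|exact: (subV sM)]|exact: (subV sH)|by gsimp].
exists P, ret; split.
- split => //; apply/finite_index_fidx => //.
  (* If [R x] is [n * D] times [z] in [A], then [x * z^-1] lies in [M], so [K2] is contained in [P].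
     Its index is finite because [A] is a lattice. *)
  pose K2 := [set x | K x /\ [set z ^+ (n * D) | z in A] (i (R x))].
  have fK2 : fidx K2 K.
    apply: (@fidx_preimage _ _ K A) => //.
      by move=> x y Kx Ky; rewrite R_M// iD.
    by rewrite -(prednK nD_gt0); apply: fpA.
  apply: fidxS (fidx_trans _ sK _ _ fK2 fK) => // x [Kx [z Az zE]].
  exists (x * z^-1), z; split; [|by case: Az|by gsimp].
  have Kz : K z by case: Az.
  split; first by apply: subM => //; apply: subV.
  rewrite R_M// ?(additive_onV sK R_M)//; last exact: subV.
  apply: i_inj; rewrite iD zmorphN// -zE -{2}(gK z Az) R_A (zmorphMn iD) gK//.
  by rewrite mulgV (zmorph0 iD).
- by move=> x Hx; exists 1, x; split; [exact: (sub1 sM)| |rewrite mul1g].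
- move=> _ _ [m [h [Mm Hh ->]]] [m' [h' [Mm' Hh' ->]]]; rewrite PM !retP//.
    by apply: (subM sM) => //; apply: MJ.
  exact: (subM sH).
- by move=> _ [m [h [Mm Hh ->]]]; rewrite retP.
- by move=> x Hx; rewrite -{1}(mul1g x) retP//; exact: (sub1 sM).
Qed.

(** * Gluing actions and cocycles *)

Section Actions.
Variables (G : groupType) (X : choiceType) (a : G -> X -> X).
Hypothesis aA : is_action a.

Lemma actK g : cancel (a g) (a g^-1).
Proof. by move=> x; rewrite -aA.2 mulVg aA.1. Qed.

Lemma orbit_reps (x0 : X) : exists (tau : X -> X) (p : X -> G),
  (forall x, a (p x) (tau x) = x) /\ (forall g x, tau (a g x) = tau x).
Proof.
pose tau x := xget x0 [set y | exists g, a g y = x].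
have [p pP] : exists p : X -> G, forall x, a (p x) (tau x) = x.
  suff /choice[p ?] : forall x, exists g, a g (tau x) = x by exists p.
  move=> x; apply: (@xgetPex _ x0 [set y | exists g, a g y = x]).
  by exists x, 1; apply: aA.1.
exists tau, p; split=> // g x; congr xget; apply/funext => y; apply/propext.
split=> -[h hy]; last by exists (g * h); rewrite aA.2 hy.
by exists (g^-1 * h); rewrite aA.2 hy actK.
Qed.
End Actions.

Lemma addr_telescope (V : zmodType) (u w r s v : V) :
  ((u + w - r) + (s + v - w) = u + s + v - r)%R.
Proof.
rewrite [(u + w - r)%R]GRing.addrAC [X in X = _]GRing.addrACA GRing.subrr.
by rewrite GRing.addr0 GRing.addrAC !GRing.addrA.
Qed.

Section Glue.
Variables (G0 G1 G2 G : groupType).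
Variables (f1 : {multiplicative G0 -> G1}) (f2 : {multiplicative G0 -> G2}).
Variables (j1 : {multiplicative G1 -> G}) (j2 : {multiplicative G2 -> G}).
Hypothesis am : amalgamated_product f1 f2 j1 j2.

Section Cocycle.
Variables (O : choiceType) (V : zmodType) (a : G -> O -> O).
Variables (A1 : G1 -> O -> V) (A2 : G2 -> O -> V).
Hypothesis aA : is_action a.
Hypothesis A1M : forall g h z, A1 (g * h) z = (A1 g (a (j1 h) z) + A1 h z)%R.
Hypothesis A2M : forall g h z, A2 (g * h) z = (A2 g (a (j2 h) z) + A2 h z)%R.
Hypothesis A12 : forall c z, a (j1 (f1 c)) z = z -> A1 (f1 c) z = A2 (f2 c) z.

Let j12 c : j2 (f2 c) = j1 (f1 c).
Proof. by case: am => _ _ + _ => /(_ c). Qed.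

(* Cocycles that agree on the stabilizers of G0 are cohomologous over G0. *)
Lemma amalgam_cocycle_stab (o : O) : exists phi : G -> V,
  (forall g x, phi (j1 g * x) = (A1 g (a x o) + phi x)%R) /\
  forall x y, a y o = o -> phi (x * y) = (phi x + phi y)%R.
Proof.
pose a0 c := a (j1 (f1 c)).
have a0A : is_action a0.
  by split=> [z|g h z]; rewrite /a0 ?morph1 ?gmulfM ?aA.1 ?aA.2.
have [tau [p [pE tauE]]] := orbit_reps a0A o.
(* The obstruction to gluing: a cocycle of [G0] that vanishes on stabilizers. *)
pose D c z := (A2 (f2 c) z - A1 (f1 c) z)%R.
have DM c c' z : D (c * c') z = (D c (a0 c' z) + D c' z)%R.
  by rewrite /D !gmulfM A1M A2M j12 GRing.opprD GRing.addrACA.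
have D0 c z : a0 c z = z -> D c z = 0%R.
  by move=> /A12; rewrite /D => ->; rewrite GRing.subrr.
(* [D] is integrated from the orbit representative [tau z] to [z]; its vanishing on stabilizers
   makes [D] the coboundary of [b]. *)
pose b z := D (p z) (tau z).
have bE c z : D c z = (b (a0 c z) - b z)%R.
  have sE : a0 ((p (a0 c z))^-1 * (c * p z)) (tau z) = tau z.
    by rewrite !a0A.2 pE -{2}[a0 c z]pE tauE actK.
  have := DM (p (a0 c z)) ((p (a0 c z))^-1 * (c * p z)) (tau z).
  rewrite mulVKg sE (D0 _ _ sE) GRing.addr0 DM pE => e.
  by rewrite /b tauE -e GRing.addrK.
(* Cohomologous to [A2], and equal to [A1] over [G0]. *)
pose B2 g z := (A2 g z + b z - b (a (j2 g) z))%R.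
pose T := Algebra.to_multiplicative V.
have [||c x|phi [phi1 phi_1 phi_2]] := amalgam_cocycle am (T := T)
    (a1 := fun g x => A1 g (a x o)) (a2 := fun g x => B2 g (a x o)).
- by move=> g h x; rewrite A1M aA.2.
- move=> g h x; rewrite /B2 A2M !gmulfM !aA.2.
  exact/esym/addr_telescope.
- have := bE c (a x o); rewrite /B2 /D /a0 -j12 => /(congr1 (fun v => v + A1 (f1 c) (a x o))%R).
  rewrite GRing.subrK => ->.
  by rewrite [(_ + A1 _ _)%R]GRing.addrC -[(_ + _ + b (a x o))%R]GRing.addrA GRing.subrK GRing.addrK.
exists phi; split; first exact: phi_1.
move=> x y yo; pose P x := phi (x * y) = (phi x + phi y)%R.
apply: (amalgam_ind am (P := P)) => [|g z Pz|g z Pz]; rewrite /P.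
- by rewrite mul1g phi1; apply/esym/GRing.add0r.
- rewrite -mulgA !phi_1 Pz aA.2 yo; apply: GRing.addrA.
- rewrite -mulgA !phi_2 Pz aA.2 yo; apply: GRing.addrA.
Qed.
End Cocycle.

Section PairAction.
Variables (X1 X2 : choiceType) (b1 : G1 -> X1 -> X1) (b2 : G2 -> X2 -> X2).
Variable M0 : set G0.
Hypotheses (b1A : is_action b1) (b2A : is_action b2).
Hypothesis stab1 : forall c x, b1 (f1 c) x = x <-> M0 c.
Hypothesis stab2 : forall c x, b2 (f2 c) x = x <-> M0 c.

(* All orbits of G0 in X1 and X2 are copies of G0/M0. The involution th exchanges
   the G0-coordinates of x and y, so it intertwines the actions of G0 on the two
   factors; hence G2 can act through th on the second factor. *)
Lemma pair_action (x0 : X1) (y0 : X2) :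
  exists (a : G -> X1 * X2 -> X1 * X2) (th : X1 * X2 -> X1 * X2),
    [/\ is_action a, forall g z, a (j1 g) z = (b1 g z.1, z.2),
        forall g z, th (a (j2 g) z) = ((th z).1, b2 g (th z).2), involutive th
      & forall z, exists c d x y, z = (b1 (f1 c) x, b2 (f2 d) y) /\
          th z = (b1 (f1 d) x, b2 (f2 c) y)].
Proof.
have act0 (H : groupType) (f : {multiplicative G0 -> H}) (X : choiceType)
    (b : H -> X -> X) : is_action b -> is_action (fun c => b (f c)).
  by move=> bA; split=> [x|g h x]; rewrite ?morph1 ?gmulfM ?bA.1 ?bA.2.
have a1A := act0 _ f1 _ _ b1A; have a2A := act0 _ f2 _ _ b2A.
have [t1 [p1 [p1E t1E]]] := orbit_reps a1A x0.
have [t2 [p2 [p2E t2E]]] := orbit_reps a2A y0.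
have same1 c c' x : b1 (f1 c) x = b1 (f1 c') x -> forall y, b2 (f2 c) y = b2 (f2 c') y.
  move=> e y; have /stab1 M0c : b1 (f1 (c^-1 * c')) x = x.
    by rewrite gmulfM b1A.2 -e -b1A.2 -gmulfM mulVg morph1 b1A.1.
  by rewrite -[c'](mulVKg c) gmulfM b2A.2 ((stab2 _ y).2 M0c).
have same2 c c' y : b2 (f2 c) y = b2 (f2 c') y -> forall x, b1 (f1 c) x = b1 (f1 c') x.
  move=> e x; have /stab2 M0c : b2 (f2 (c^-1 * c')) y = y.
    by rewrite gmulfM b2A.2 -e -b2A.2 -gmulfM mulVg morph1 b2A.1.
  by rewrite -[c'](mulVKg c) gmulfM b1A.2 ((stab1 _ x).2 M0c).
have t1K x : t1 (t1 x) = t1 x by rewrite -{2}(p1E x) t1E.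
have t2K y : t2 (t2 y) = t2 y by rewrite -{2}(p2E y) t2E.
pose th (z : X1 * X2) := (b1 (f1 (p2 z.2)) (t1 z.1), b2 (f2 (p1 z.1)) (t2 z.2)).
have thK : involutive th.
  move=> [x y]; rewrite /th /=; set x' := b1 _ (t1 x); set y' := b2 _ (t2 y).
  have t1' : t1 x' = t1 x by rewrite /x' t1E t1K.
  have t2' : t2 y' = t2 y by rewrite /y' t2E t2K.
  rewrite t1' t2' (same2 (p2 y') (p1 x) (t2 y)) ?p1E; last by rewrite -{1}t2' p2E.
  by rewrite (same1 (p1 x') (p2 y) (t1 x)) ?p2E// -{1}t1' p1E.
pose c2 g z := th ((th z).1, b2 g (th z).2).
have [||c z|a [aA aj1 aj2]] := glue_action am (X := (X1 * X2)%type)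
    (a1 := fun g z => (b1 g z.1, z.2)) (a2 := c2).
- by split=> [[x y]|g h [x y]] /=; rewrite ?b1A.1 ?b1A.2.
- split=> [z|g h z]; rewrite /c2 ?b2A.1 -?surjective_pairing ?thK //=.
  by rewrite b2A.2.
- apply: (inv_inj thK); rewrite /c2 thK /th /= t1E; congr pair.
  rewrite (same1 (p1 (b1 (f1 c) z.1)) (c * p1 z.1) (t1 z.1)).
    by rewrite gmulfM b2A.2.
  by rewrite -(t1E c) p1E t1E gmulfM b1A.2 p1E.
exists a, th; split=> //.
- by move=> g z; rewrite aj2 /c2 thK.
- by move=> [x y]; exists (p1 x), (p2 y), (t1 x), (t2 y); rewrite p1E p2E.
Qed.
End PairAction.

(** When [pair_action] is applied to the regular actions of [G1] and [G2], [j1 g] moves [(1, 1)] to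
    [(g, 1)], which recovers [g]. *)
Lemma amalgam_injective : injective j1.
Proof.
have act (H : groupType) : is_action (fun g x : H => g * x).
  by split=> [x|g h x]; rewrite ?mul1g ?mulgA.
have st (H : groupType) (f : {multiplicative G0 -> H}) : injective f ->
    forall c x, f c * x = x <-> [set 1] c.
  move=> fI c x; split=> [|->]; last by rewrite morph1 mul1g.
  by rewrite -{2}(mul1g x) -(morph1 f) => /mulIg /fI.
have [i1 i2 _ _] := am.
have [a [_ [_ aj1 _ _ _]]] := pair_action (act G1) (act G2) (st _ f1 i1) (st _ f2 i2) 1 1.
move=> g h e; have := aj1 g (1, 1); rewrite e aj1 /= !mulg1.
by case.
Qed.

End Glue.

Lemma int_additive (V : zmodType) (F : int -> V) :
  {morph F : m n / (m + n)%R} -> forall n, F n = (F 1 *~ n)%R.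
Proof.
move=> FD; have F0 : F 0%R = 0%R.
  by apply: (GRing.addrI (F 0%R)); rewrite -FD !GRing.addr0.
have Fn (n : nat) : F n = (F 1 *~ n)%R.
  elim: n => [|n IH]; first by rewrite F0 mulr0z.
  by rewrite -addn1 PoszD FD IH mulrzDr mulr1z.
case=> n //; apply: (GRing.addIr (F n.+1)).
by rewrite NegzE -FD GRing.addNr F0 Fn -mulrzDr GRing.addNr mulr0z.
Qed.

(** * The action on cosets and the induced cocycle *)

Section CosetAction.
Variables (H : groupType) (M : set H) (V : zmodType) (w : H -> V).
Variables (n : nat) (kappa : H -> 'I_n) (r : 'I_n -> H).
Hypotheses (sM : subgroup M) (nM : forall x y, M y -> M (y ^ x)).
Hypothesis wM : forall x y, M x -> M y -> w (x * y) = (w x + w y)%R.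
Hypothesis rk : forall i, kappa (r i) = i.
Hypothesis kP : forall x y, (kappa x = kappa y) <-> M (x^-1 * y).

Definition coset_act g i := kappa (g * r i).
(** The cocycle on H/M that corresponds to [w] under Shapiro's lemma; its sum over [i] would be the
    transfer. *)
Definition coset_cocycle g i := w ((r (coset_act g i))^-1 * g * r i).

Lemma coset_act_mem g i : M ((r (coset_act g i))^-1 * g * r i).
Proof. by rewrite -mulgA; apply/kP; rewrite rk. Qed.

Lemma coset_actM g h i : coset_act (g * h) i = coset_act g (coset_act h i).
Proof.
apply/kP; have := subV sM (coset_act_mem h i); by gsimp.
Qed.

Lemma coset_act_is_action : is_action coset_act.
Proof.
by split=> [i|g h i]; [rewrite /coset_act mul1g|apply: coset_actM].
Qed.

Lemma coset_act_stab g i : coset_act g i = i <-> M g.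
Proof.
split=> [|Mg].
  rewrite -{2}(rk i) => /kP /(nM (r i)^-1); rewrite conjgE; gsimp.
  by move/(subV sM); rewrite invgK.
rewrite -[RHS]rk; apply/kP.
have := nM (r i) (subV sM Mg); rewrite conjgE; by gsimp.
Qed.

Lemma coset_cocycleM g h i :
  coset_cocycle (g * h) i = (coset_cocycle g (coset_act h i) + coset_cocycle h i)%R.
Proof.
rewrite /coset_cocycle -wM; try exact: coset_act_mem.
by rewrite coset_actM; gsimp.
Qed.

Lemma coset_cocycle1 i : coset_cocycle 1 i = 0%R.
Proof.
apply: (GRing.addrI (coset_cocycle 1 i)).
have := coset_cocycleM 1 1 i; rewrite mulg1 (coset_act_is_action.1 i) => <-.
by rewrite GRing.addr0.
Qed.

Lemma coset_cocycle_base g : M g -> coset_cocycle g (kappa 1) = w g.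
Proof.
move=> Mg; rewrite /coset_cocycle ((coset_act_stab _ _).2 Mg).
set t := r _; have Mt : M t.
  by have := (kP 1 t).1; rewrite invg1 mul1g; apply; rewrite rk.
have Mt' := subV sM Mt; rewrite !wM//; last exact: subM.
by rewrite (additive_onV sM wM)// GRing.addrAC GRing.addNr GRing.add0r.
Qed.

Lemma coset_cocycle_conj m g i :
  coset_act m (coset_act g i) = coset_act g i ->
  coset_cocycle m (coset_act g i) = coset_cocycle (g^-1 * m * g) i.
Proof.
move=> mg; apply: (GRing.addIr (coset_cocycle g i)); rewrite -coset_cocycleM.
have -> : m * g = g * (g^-1 * m * g) by gsimp.
rewrite coset_cocycleM GRing.addrC; congr (_ + coset_cocycle g _)%R.
by rewrite !coset_actM mg -coset_actM mulVg (coset_act_is_action.1 i).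
Qed.
End CosetAction.

(** * Extending multiples of a homomorphism from one factor to the amalgam *)

Section GluePower.
Variables (G0 G1 G2 G : groupType).
Variables (f1 : {multiplicative G0 -> G1}) (f2 : {multiplicative G0 -> G2}).
Variables (j1 : {multiplicative G1 -> G}) (j2 : {multiplicative G2 -> G}).
Hypothesis am : amalgamated_product f1 f2 j1 j2.
Variables (M1 : set G1) (M2 : set G2) (V : zmodType) (w : G1 -> V).
Hypotheses (nfM1 : normal_fidx M1) (nfM2 : normal_fidx M2).
Hypothesis M12 : forall c, M1 (f1 c) <-> M2 (f2 c).
Hypothesis wM : forall x y, M1 x -> M1 y -> w (x * y) = (w x + w y)%R.

Let sM1 : subgroup M1 := let: And3 h _ _ := nfM1 in h.
Let nM1 : forall x y, M1 y -> M1 (y ^ x) := let: And3 _ h _ := nfM1 in h.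
Let sM2 : subgroup M2 := let: And3 h _ _ := nfM2 in h.
Let nM2 : forall x y, M2 y -> M2 (y ^ x) := let: And3 _ h _ := nfM2 in h.

Section Core.
Variables (n1 n2 : nat) (k1 : G1 -> 'I_n1) (r1 : 'I_n1 -> G1).
Variables (k2 : G2 -> 'I_n2) (r2 : 'I_n2 -> G2).
Hypotheses (rk1 : forall i, k1 (r1 i) = i) (rk2 : forall i, k2 (r2 i) = i).
Hypothesis kP1 : forall x y, (k1 x = k1 y) <-> M1 (x^-1 * y).
Hypothesis kP2 : forall x y, (k2 x = k2 y) <-> M2 (x^-1 * y).
Local Notation b1 := (coset_act k1 r1).
Local Notation b2 := (coset_act k2 r2).
Local Notation w1 := (coset_cocycle w k1 r1).
Variables (U : 'I_n2 -> int) (A2 : G2 -> 'I_n1 -> 'I_n2 -> V).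
Hypothesis A2M : forall g h x y, A2 (g * h) x y = (A2 g x (b2 h y) + A2 h x y)%R.
Hypothesis UA : forall m c d x y, M1 (f1 m) ->
  (w1 (f1 m) (b1 (f1 c) x) *~ U (b2 (f2 d) y))%R = A2 (f2 m) (b1 (f1 d) x) (b2 (f2 c) y).

(** At [(x, y)] the cocycle of [G1] is [w1] at [x] scaled by [U y]. That of [G2] is [A2] read at the
    image of [(x, y)] under the involution of [pair_action], where the [G0]-coordinates are
    exchanged; [UA] is their agreement on the stabilizers in [G0]. [K] is the kernel of the action
    on the finite set of pairs. *)
Lemma glue_power_core : exists K (phi : G -> V),
  [/\ normal_fidx K, forall x y, K x -> K y -> phi (x * y) = (phi x + phi y)%R
    & forall g, K (j1 g) -> M1 g /\ phi (j1 g) = (w g *~ U (k2 1))%R].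
Proof.
have b1A := coset_act_is_action sM1 rk1 kP1.
have b2A := coset_act_is_action sM2 rk2 kP2.
have st1 := coset_act_stab sM1 nM1 rk1 kP1.
have st2 := coset_act_stab sM2 nM2 rk2 kP2.
have [||a [th [aA aj1 aj2 thK thE]]] := pair_action am b1A b2A
    (M0 := fun c => M1 (f1 c)) _ _ (k1 1) (k2 1).
- by move=> c x; apply: st1.
- by move=> c x; rewrite st2; apply: iff_sym.
have [|||phi [phi1 phiM]] := amalgam_cocycle_stab am
  (A1 := fun g z => (w1 g z.1 *~ U z.2)%R)
  (A2 := fun g z => A2 g (th z).1 (th z).2) aA _ _ _ (k1 1, k2 1).
- by move=> g h z; rewrite aj1 (coset_cocycleM sM1 wM rk1 kP1) mulrzDl.
- by move=> g h z; rewrite aj2 A2M.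
- move=> c z zc; have Mc : M1 (f1 c) by move: zc; rewrite aj1; case: (z) => x y [/st1].
  by have [c' [d [x [y [-> ->]]]]] := thE z; rewrite UA.
pose K := [set g | forall z, a g z = z].
have KM : forall x y, K x -> K y -> phi (x * y) = (phi x + phi y)%R.
  by move=> x y _ Ky; apply: phiM.
have sK : subgroup K.
  split=> [z|x y Kx Ky z|x Kx z]; rewrite ?aA.1 ?aA.2 ?Ky ?Kx//.
  by rewrite -{1}(Kx z) actK.
exists K, phi; split => //.
- split=> //.
  + by move=> x y Ky z; rewrite conjgE !aA.2 Ky actK.
  + apply: (fidx_fin (kappa := fun x => [ffun z => a x z])) => x y _ _ /ffunP e z.
    by have := e z; rewrite !ffunE aA.2 => <-; rewrite actK.
- move=> g Kg; have Mg : M1 g.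
    by have := Kg (k1 1, k2 1); rewrite aj1 => -[/st1].
  split=> //; have p1 : phi 1 = 0%R by apply: (additive_on1 sK KM).
  rewrite -[j1 g]mulg1 phi1 p1 GRing.addr0 aA.1 /=.
  by rewrite (coset_cocycle_base sM1 nM1 wM rk1 kP1).
Qed.
End Core.

(** The stabilizers in [G0] are trivial and nothing has to match, so the weight 1 and the zero
    cocycle of [G2] will do. *)
Lemma glue_power_trivial : (forall c, M1 (f1 c) -> c = 1) ->
  exists K (phi : G -> V),
  [/\ normal_fidx K, forall x y, K x -> K y -> phi (x * y) = (phi x + phi y)%R
    & forall g, K (j1 g) -> M1 g /\ phi (j1 g) = w g].
Proof.
move=> M0; have [_ _ fM1] := nfM1; have [_ _ fM2] := nfM2.
have [n1 [k1 [r1 [_ rk1 kP1]]]] := fidx_reps sM1 Logic.I fM1.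
have [n2 [k2 [r2 [_ rk2 kP2]]]] := fidx_reps sM2 Logic.I fM2.
have {}kP1 x y : k1 x = k1 y <-> M1 (x^-1 * y) by apply: kP1.
have {}kP2 x y : k2 x = k2 y <-> M2 (x^-1 * y) by apply: kP2.
have [||K [phi [nK phiM phi1]]] := glue_power_core rk1 rk2 kP1 kP2
  (U := fun=> 1%R) (A2 := fun _ _ _ => 0%R).
- by move=> *; rewrite GRing.addr0.
- by move=> m c d x y /M0 ->; rewrite mulr1z morph1 (coset_cocycle1 sM1 wM rk1 kP1).
by exists K, phi; split=> // g /phi1; rewrite mulr1z.
Qed.

(* The weight W(x) U(y) of ga 1 at (x, y) is a multiple of W for fixed y and a
   multiple of U for fixed x, so it extends to cocycles of G1 and of G2. *)
Lemma glue_power_cyclic (ga : int -> G0) (u : G2 -> int) :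
  {morph ga : m n / (m + n)%R >-> m * n} ->
  (forall c, M1 (f1 c) <-> exists n, c = ga n) ->
  (forall x y, M2 x -> M2 y -> u (x * y) = (u x + u y)%R) ->
  exists K (phi : G -> V),
  [/\ normal_fidx K, forall x y, K x -> K y -> phi (x * y) = (phi x + phi y)%R
    & forall g, K (j1 g) -> M1 g /\ phi (j1 g) = (w g *~ u (f2 (ga 1%R)))%R].
Proof.
move=> gaD gaM uM; have [_ _ fM1] := nfM1; have [_ _ fM2] := nfM2.
have [n1 [k1 [r1 [_ rk1 kP1]]]] := fidx_reps sM1 Logic.I fM1.
have [n2 [k2 [r2 [_ rk2 kP2]]]] := fidx_reps sM2 Logic.I fM2.
have {}kP1 x y : k1 x = k1 y <-> M1 (x^-1 * y) by apply: kP1.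
have {}kP2 x y : k2 x = k2 y <-> M2 (x^-1 * y) by apply: kP2.
have M1ga n : M1 (f1 (ga n)) by apply/gaM; exists n.
have M2ga n : M2 (f2 (ga n)) by apply/M12.
have st1 := coset_act_stab sM1 nM1 rk1 kP1.
have st2 := coset_act_stab sM2 nM2 rk2 kP2.
pose w1 := coset_cocycle w k1 r1; pose u2 := coset_cocycle u k2 r2.
have w1n n x : w1 (f1 (ga n)) x = (w1 (f1 (ga 1%R)) x *~ n)%R.
  apply: (int_additive (F := fun n => w1 (f1 (ga n)) x)) => m m'.
  by rewrite gaD gmulfM /w1 (coset_cocycleM sM1 wM rk1 kP1) (st1 _ _).2.
have u2n n x : u2 (f2 (ga n)) x = (u2 (f2 (ga 1%R)) x *~ n)%R.
  apply: (int_additive (F := fun n => u2 (f2 (ga n)) x)) => m m'.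
  by rewrite gaD gmulfM /u2 (coset_cocycleM sM2 uM rk2 kP2) (st2 _ _).2.
(* Moving a point by [c] multiplies its weight by [e c], in either factor. The product of the
   weights at the points moved by [c] and by [d] is thus symmetric in [c] and [d], as the exchange
   of coordinates requires. *)
have [e eP] : exists e : G0 -> int, forall c, c^-1 * ga 1%R * c = ga (e c).
  suff /choice[e ?] : forall c, exists n, c^-1 * ga 1%R * c = ga n by exists e.
  move=> c; apply/gaM; rewrite -mulgA -conjgE.
  have := nM1 (f1 c) (M1ga 1%R).
  by rewrite !conjgE !gmulfM morphV.
have w1c c x : w1 (f1 (ga 1%R)) (coset_act k1 r1 (f1 c) x) = (w1 (f1 (ga 1%R)) x *~ e c)%R.
  rewrite /w1 (coset_cocycle_conj sM1 wM rk1 kP1); last exact/st1.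
  by rewrite -morphV -!gmulfM eP; apply: w1n.
have u2c c x : u2 (f2 (ga 1%R)) (coset_act k2 r2 (f2 c) x) = (u2 (f2 (ga 1%R)) x *~ e c)%R.
  rewrite /u2 (coset_cocycle_conj sM2 uM rk2 kP2); last exact/st2.
  by rewrite -morphV -!gmulfM eP; apply: u2n.
have [||K [phi [nK phiM phi1]]] := glue_power_core rk1 rk2 kP1 kP2
  (U := fun y => u2 (f2 (ga 1%R)) y)
  (A2 := fun g x y => (w1 (f1 (ga 1%R)) x *~ u2 g y)%R).
- by move=> g h x y; rewrite /u2 (coset_cocycleM sM2 uM rk2 kP2) mulrzDr.
- move=> _ c d x y /gaM[n ->]; rewrite -/w1 (w1n n) (u2n n) !w1c !u2c.
  rewrite -!mulrzA; congr (_ *~ _)%R; rewrite !mulrzz.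
  by rewrite GRing.mulrA [RHS]GRing.mulrCA [(e d * _)%R]GRing.mulrC [RHS]GRing.mulrCA.
exists K, phi; split=> // g /phi1.
by rewrite /u2 (coset_cocycle_base sM2 nM2 uM rk2 kP2).
Qed.
End GluePower.

(** * Homomorphisms to the integers *)

Lemma int_subgroup (P : int -> Prop) :
  P 0%R -> (forall m n, P m -> P n -> P (m - n)%R) -> (exists2 n, n != 0%R & P n) ->
  exists k : nat, forall n, P n <-> (k.+1 %| n)%Z.
Proof.
move=> P0 PB [n0 n0_neq0 Pn0].
have PN m : P m -> P (- m)%R by move=> /(PB _ _ P0); rewrite GRing.sub0r.
have PD m n : P m -> P n -> P (m + n)%R.
  by move=> Pm /PN Pn; have := PB _ _ Pm Pn; rewrite GRing.opprK.
have PMn m (n : nat) : P m -> P (m * n)%R.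
  move=> Pm; elim: n => [|n IH]; first by rewrite GRing.mulr0.
  by rewrite -addn1 PoszD GRing.mulrDr GRing.mulr1; apply: PD.
have PM m n : P m -> P (m * n)%R.
  by case: n => n Pm; rewrite ?NegzE ?GRing.mulrN; [|apply: PN]; apply: PMn.
have ex : exists k : nat, `[< P k.+1 >].
  exists (`|n0|.-1)%N; apply/asboolP; rewrite prednK ?absz_gt0//.
  by case: (n0) Pn0 => // m /PN; rewrite NegzE GRing.opprK.
case: (ex_minnP ex) => k /asboolP Pk kmin; exists k => n; split; last first.
  by move=> /dvdzP[q ->]; rewrite GRing.mulrC; apply: PM.
move=> Pn; apply/dvdz_mod0P; set m := (n %% k.+1)%Z.
have Pm : P m.
  have -> : m = (n - k.+1%:Z * (n %/ k.+1)%Z)%R.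
    by rewrite {1}(divz_eq n k.+1) GRing.mulrC GRing.addrC GRing.addKr.
  by apply: PB => //; apply: PM.
have m_ge0 : (0 <= m)%R by apply: modz_ge0.
have : (m < k.+1)%R by apply: ltz_pmod.
case: m Pm m_ge0 => // -[|m] // Pm _; rewrite ltz_nat ltnS ltnNge.
by rewrite kmin//; apply/asboolP.
Qed.

Lemma fidx1_finite (G : groupType) : fidx [set (1 : G)] setT -> finite_set [set: G].
Proof.
move=> [n [k kP]].
apply: (@sub_finite_set _ _ ((fun i => xget 1 [set x | k x = i]) @` setT)).
  move=> x _; exists (k x) => //; apply/esym/divg1_eq.
  set y := xget _ _; have ky : k y = k x.
    by apply: (@xgetPex _ 1 [set z | k z = k x]); exists x.
  have := kP y x Logic.I Logic.I ky => /= yx.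
  by rewrite -[x](mulVKg y) yx mulg1 mulgV.
exact: finite_image.
Qed.

Lemma abelian_generated1 (G : groupType) (x : G) : abelian_subgroup (generated [set x]).
Proof.
split; first exact: subgroup_generated.
have sC (y : G) : subgroup [set z | commute y z].
  split=> [|u v|u] /=; [exact: commute1|exact: commuteM|exact: commuteV].
move=> y z gy; apply: (generated_sub (sC y)) => _ ->; apply: commute_sym.
by apply: (generated_sub (sC x)) gy => _ ->; apply: commute_refl.
Qed.

Lemma virtually_cyclic_infinite (G : groupType) :
  virtually_cyclic [set: G] -> infinite_set [set: G] ->
  exists ga : int -> G, [/\ {morph ga : m n / (m + n)%R >-> m * n}, injective ga
    & fidx (range ga) setT].
Proof.
move=> [H [[sH _ fH] [x HE]]] infG.
have {}fH : fidx H setT by apply/finite_index_fidx.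
have [V [i [i_inj iD iE]]] := abelian_zmodType (abelian_generated1 x).
have [v0 _ v0E] : range i x by rewrite iE; apply: sub_generated.
pose ga n := i (v0 *~ n)%R.
have gaD : {morph ga : m n / (m + n)%R >-> m * n}.
  by move=> m n; rewrite /ga mulrzDr iD.
have ga0 : ga 0%R = 1 by rewrite /ga mulr0z (zmorph0 iD).
have gaN n : ga (- n)%R = (ga n)^-1 by rewrite /ga mulrNz (zmorphN iD).
have s_ga : subgroup (range ga).
  split; first by exists 0%R.
    by move=> _ _ [m _ <-] [n _ <-]; exists (m + n)%R.
  by move=> _ [m _ <-]; exists (- m)%R.
have H_ga : H `<=` range ga.
  by rewrite HE; apply: generated_sub => // _ ->; exists 1%R => //; rewrite /ga mulr1z.
have f_ga : fidx (range ga) setT by apply: fidxS fH.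
exists ga; split=> //.
have ga_eq1 m : ga m = 1 -> m = 0%R.
  move=> gm; apply: contrapT => m0; apply: infG.
  apply: fidx1_finite; apply: (fidx_trans _ s_ga) f_ga => //.
  have [g gK] := right_inverse_on_range (0 : int)%R ga.
  have [k kP] := int_residue (`|m|.-1)%N.
  exists _, (k \o g) => y z ry rz /kP.
  rewrite prednK ?absz_gt0; last exact/eqP.
  move=> mgg; have /dvdzP[q qE] : (m %| (g z - g y)%R)%Z by [].
  rewrite -(gK y ry) -(gK z rz) -gaN -gaD GRing.addrC qE /=.
  by rewrite /ga GRing.mulrC mulrzA -/(ga m) (_ : v0 *~ m = 0)%R ?mul0rz ?(zmorph0 iD)//;
    apply: i_inj; rewrite (zmorph0 iD).
move=> m n e; apply/eqP; rewrite -GRing.subr_eq0; apply/eqP/ga_eq1.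
by rewrite gaD gaN e mulgV.
Qed.

Lemma int_morph_inverse (G : groupType) (ga : int -> G) :
  {morph ga : m n / (m + n)%R >-> m * n} -> injective ga ->
  exists g : G -> int, cancel ga g /\
    (forall x y, range ga x -> range ga y -> g (x * y) = (g x + g y)%R).
Proof.
move=> gaD ga_inj.
have [g gK'] := right_inverse_on_range (0 : int)%R ga.
have gK n : g (ga n) = n by apply: ga_inj; apply: gK'; exists n.
exists g; split=> // _ _ [m _ <-] [n _ <-].
by rewrite -gaD !gK.
Qed.

Lemma subgroup_range_int (G : groupType) (ga : int -> G) :
  {morph ga : m n / (m + n)%R >-> m * n} -> subgroup (range ga).
Proof.
move=> gaD; split; first by exists 0%R => //; apply: (zmorph0 gaD).
  by move=> _ _ [m _ <-] [n _ <-]; exists (m + n)%R.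
by move=> _ [m _ <-]; exists (- m)%R => //; apply: (zmorphN gaD).
Qed.

Lemma subgroup1 (G : groupType) : subgroup [set (1 : G)].
Proof. by split=> // [x y -> ->|x ->]; rewrite ?mulg1 ?invg1. Qed.

Lemma lattice_image (G T : groupType) (f : {multiplicative G -> T}) (L : set G) :
  injective f -> lattice L -> lattice (f @` L).
Proof.
move=> f_inj [[sL cL] tL pL].
have fM : hom_on L f by move=> x y _ _; apply: gmulfM.
split.
- split; first exact: subgroup_image_on.
  by move=> _ _ [x Lx <-] [y Ly <-]; rewrite /commute -!gmulfM cL.
- move=> _ n [x Lx <-]; rewrite -(hom_onX sL fM)//.
  rewrite -(morph1 f) => /f_inj /tL -> //.
- move=> n; have [k [kappa kP]] := pL n.
  have [g gK'] := right_inverse_on_range (1 : G) f.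
  have gK x : g (f x) = x by apply: f_inj; apply: gK'; exists x.
  exists k, (kappa \o g) => _ _ [x Lx <-] [y Ly <-] /=; rewrite !gK.
  move=> /(kP _ _ Lx Ly)[z Lz zE]; exists (f z); first by exists z.
  by rewrite -(hom_onX sL fM)// zE gmulfM morphV.
Qed.

Lemma fidx_range (G T : groupType) (f : {multiplicative G -> T}) (L : set G) :
  fidx L setT -> fidx (f @` L) (range f).
Proof.
move=> [n [k kP]].
have [g gK'] := right_inverse_on_range (1 : G) f.
have gK x : f (g (f x)) = f x by apply: gK'; exists x.
exists n, (k \o g) => _ _ [x _ <-] [y _ <-] /= /(kP _ _ Logic.I Logic.I) Lxy.
by exists ((g (f x))^-1 * g (f y)) => //; rewrite gmulfM morphV !gK.
Qed.

(** * Normal subgroups of finite index and their traces on the edge group *)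

Section EdgeData.
Variables (G0 H : groupType) (f : {multiplicative G0 -> H}).
Hypotheses (f_inj : injective f) (vrf : virtual_retract (range f)).

(** For a finite edge group [L] can be the trivial subgroup; a power retraction into it has a domain
    that meets the edge group trivially. *)
Lemma edge_trivial : finite_set [set: G0] ->
  exists K, normal_fidx K /\ forall c, K (f c) -> c = 1.
Proof.
move=> finG0.
have f1 : fidx [set (1 : G0)] setT.
  by apply/finite_index_fidx; [exact: subgroup1| |apply: finite_image; apply: finG0].
have e1 : f @` [set 1] = [set 1] by rewrite image_set1 morph1.
have [||||K [r [nK _ _ Kr _]]] := @virtual_retract_power H (range f) [set 1] _ vrf.
- exact: subgroup_range.
- exact: subgroup1.
- by move=> _ ->; exists 1 => //; apply: morph1.
- by rewrite -e1; apply: fidx_range.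
exists K; split=> // c Kc; apply: f_inj; rewrite morph1.
by apply: Kr; split=> //; exists c.
Qed.

Variable ga : int -> G0.
Hypotheses (gaD : {morph ga : m n / (m + n)%R >-> m * n}) (ga_inj : injective ga).
Hypothesis fga : fidx (range ga) setT.

Lemma edge_cyclic : exists K (s : H -> int),
  [/\ normal_fidx K, forall x y, K x -> K y -> s (x * y) = (s x + s y)%R,
      forall c, K (f c) -> exists n, c = ga n
    & forall n, K (f (ga n)) -> s (f (ga n)) = n].
Proof.
have fgD : {morph f \o ga : m n / (m + n)%R >-> m * n}.
  by move=> m n /=; rewrite gaD gmulfM.
have fg_inj : injective (f \o ga) by apply: inj_comp.
have eL : range (f \o ga) = f @` range ga by rewrite image_comp.
have [|||K [r [nK rM rL Kr rE]]] := @virtual_retract_power H (range f) (range (f \o ga))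
    (subgroup_range f) vrf.
- exact: subgroup_range_int.
- by move=> _ [n _ <-]; exists (ga n).
- by rewrite eL; apply: fidx_range.
have [g [gK gM]] := int_morph_inverse fgD fg_inj.
exists K, (g \o r); split=> //.
- by move=> x y Kx Ky /=; rewrite rM// gM//; apply: rL.
- move=> c Kc; have [|n _ /f_inj <-] := Kr (f c); last by exists n.
  by split=> //; exists c.
- move=> n Kn /=; rewrite rE//; first by rewrite expg1 -[f (ga n)]/((f \o ga) n) gK.
Qed.

(* M consists of the x in K whose conjugates all have s divisible by (p + 1) D,
   where D generates the group of values of s on the conjugates of f (ga k.+1). *)
Lemma edge_multiples (K : set H) (s : H -> int) :
  normal_fidx K -> (forall x y, K x -> K y -> s (x * y) = (s x + s y)%R) ->
  (forall c, K (f c) -> exists n, c = ga n) ->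
  (forall n, K (f (ga n)) -> s (f (ga n)) = n) ->
  exists k : nat, forall p : nat, exists M,
    [/\ normal_fidx M, M `<=` K
      & forall c, M (f c) <-> exists n : int, c = ga (n * (k.+1 * p.+1)%N)%R].
Proof.
move=> [sK nK fK] sD Kga sE.
have fgD m n : f (ga (m + n)%R) = f (ga m) * f (ga n) by rewrite gaD gmulfM.
have fg0 : f (ga 0%R) = 1 by rewrite (zmorph0 gaD) morph1.
have fgN n : f (ga (- n)%R) = (f (ga n))^-1 by rewrite (zmorphN gaD) morphV.
have [|||k kP] := int_subgroup (P := fun n => K (f (ga n))).
- by rewrite fg0; apply: (sub1 sK).
- by move=> m n Km Kn; rewrite fgD fgN; apply: (subM sK) => //; apply: (subV sK).
- have [e eK] := fidx_exp sK (subgroupT H) fK.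
  exists (Posz e.+1) => //; have := eK (f (ga 1%R)) Logic.I.
  by rewrite -(zmorphMn fgD) pmulrn mulrzz GRing.mul1r.
pose A g := s (f (ga k.+1) ^ g).
have Kk (l : int) : K (f (ga (l * k.+1)%R)) by apply/kP; apply: dvdz_mull.
have Kkg (l : int) g : K (f (ga (l * k.+1)%R) ^ g) by apply: nK.
have AE (l : int) g : s (f (ga (l * k.+1)%R) ^ g) = (A g * l)%R.
  rewrite (int_additive (F := fun l : int => s (f (ga (l * k.+1)%R) ^ g))).
    by rewrite GRing.mul1r mulrzz.
  by move=> m n; rewrite GRing.mulrDl fgD conjMg sD.
have A1 : A 1 = k.+1.
  by rewrite /A conjg1 sE//; apply/kP.
(* The subgroup of Z generated by the values [A g], as the intersection of all subgroups containing
   them. *)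
pose S n := forall T : int -> Prop, T 0%R -> (forall m n, T m -> T n -> T (m - n)%R) ->
  (forall g, T (A g)) -> T n.
have [|||D DP] := int_subgroup (P := S).
- by move=> T.
- by move=> m n Sm Sn T T0 TB TA; apply: (TB); [exact: (Sm T T0 TB TA)|exact: (Sn T T0 TB TA)].
- by exists (Posz k.+1) => // T _ _ /(_ 1); rewrite A1.
have DA g : ((Posz D.+1) %| A g)%Z by apply/DP => T _ _; apply.
exists k => p; pose d := (p.+1 * D.+1)%N.
pose Q := [set x | K x /\ (d %| s x)%Z].
have sQ : subgroup Q.
  split.
  - by split; [apply: (sub1 sK)|rewrite (additive_on1 sK sD) dvdz0].
  - by move=> x y [Kx dx] [Ky dy]; split; [apply: (subM sK)|rewrite sD// GRing.rpredD].
  - by move=> x [Kx dx]; split; [apply: (subV sK)|rewrite (additive_onV sK sD)// GRing.rpredN].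
have fQ : fidx Q setT.
  apply: (fidx_trans _ sK) fK => //.
  have [kap kapP] := int_residue d.-1.
  exists _, (kap \o s) => x y Kx Ky /kapP; rewrite prednK ?muln_gt0// => dxy.
  have Kx' := subV sK Kx.
  by split; [apply: (subM sK)|rewrite sD// (additive_onV sK sD)// GRing.addrC].
exists (normal_core Q); split; first exact: normal_fidx_core.
  by move=> x /normal_core_sub[].
move=> c; split=> [Qc|[n ->] g].
  have [Kc _] := normal_core_sub Qc; have [m cm] := Kga c Kc.
  have /dvdzP[l ml] : ((Posz k.+1) %| m)%Z by apply/kP; rewrite -cm.
  (* [d] divides every [A g * l], and [D.+1] is an integer combination of the [A g]. *)
  have : (d %| (Posz D.+1 * l)%R)%Z.
    have SD : S ((Posz D.+1)) by apply/DP.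
    apply: (SD (fun n => (d %| (n * l)%R)%Z)).
    - by rewrite GRing.mul0r dvdz0.
    - by move=> u v du dv; rewrite GRing.mulrBl GRing.rpredB.
    - by move=> g; have [_] := Qc g; rewrite cm ml AE.
  rewrite /d mulnC PoszM dvdz_mul2l// => /dvdzP[q lq].
  by exists q; rewrite cm ml lq mulnC PoszM GRing.mulrA.
have -> : (n * Posz (k.+1 * p.+1)%N)%R = (n * Posz p.+1 * Posz k.+1)%R.
  by rewrite mulnC PoszM GRing.mulrA.
split=> //; rewrite AE /d PoszM GRing.mulrC.
by apply: dvdz_mul => //; apply: dvdz_mull.
Qed.
End EdgeData.

(** * Amalgams over virtually cyclic groups *)

Section VirtuallyCyclicAmalgam.
Variables (G0 G1 G2 G : groupType).
Variables (f1 : {multiplicative G0 -> G1}) (f2 : {multiplicative G0 -> G2}).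
Variables (j1 : {multiplicative G1 -> G}) (j2 : {multiplicative G2 -> G}).
Hypotheses (am : amalgamated_product f1 f2 j1 j2) (vcG0 : virtually_cyclic [set: G0]).
Hypotheses (vr1 : virtual_retract (range f1)) (vr2 : virtual_retract (range f2)).

Let f1_inj : injective f1. Proof. by case: am. Qed.
Let f2_inj : injective f2. Proof. by case: am. Qed.

Lemma glue_hom (V : zmodType) (K1 : set G1) (w : G1 -> V) : normal_fidx K1 ->
  (forall x y, K1 x -> K1 y -> w (x * y) = (w x + w y)%R) ->
  exists K (phi : G -> V) (n : nat),
  [/\ normal_fidx K, forall x y, K x -> K y -> phi (x * y) = (phi x + phi y)%R
    & forall g, K (j1 g) -> K1 g /\ phi (j1 g) = (w g *+ n.+1)%R].
Proof.
move=> nK1 wM; have [finG0|infG0] := pselect (finite_set [set: G0]).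
  have [Ka [nKa Ka1]] := edge_trivial f1_inj vr1 finG0.
  have [Kb [nKb Kb1]] := edge_trivial f2_inj vr2 finG0.
  have [|||||K [phi [nK phiM phiE]]] := @glue_power_trivial _ _ _ _ _ _ _ _ am (K1 `&` Ka) Kb V w.
  - exact: normal_fidxI.
  - by [].
  - have [[sK1 _ _] [sKa _ _] [sKb _ _]] := And3 nK1 nKa nKb.
    move=> c; split=> [[_ /Ka1 ->]|/Kb1 ->]; first by rewrite morph1; apply: (sub1 sKb).
    by rewrite morph1; split; [apply: (sub1 sK1)|apply: (sub1 sKa)].
  - by move=> x y [Kx _] [Ky _]; apply: wM.
  - by move=> c [_ /Ka1].
  by exists K, phi, 0%N; split=> // g /phiE[[]].
have [ga [gaD ga_inj fga]] := virtually_cyclic_infinite vcG0 infG0.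
have [Ka [s1 [nKa s1M Ka_ga s1E]]] := edge_cyclic f1_inj vr1 gaD ga_inj fga.
have [Kb [s2 [nKb s2M Kb_ga s2E]]] := edge_cyclic f2_inj vr2 gaD ga_inj fga.
have [||||k1 M1P] := @edge_multiples _ _ f1 _ gaD (K1 `&` Ka) s1.
- exact: normal_fidxI.
- by move=> x y [_ ?] [_ ?]; apply: s1M.
- by move=> c [_ /Ka_ga].
- by move=> n [_ /s1E].
have [k2 M2P] := @edge_multiples _ _ f2 _ gaD Kb s2 nKb s2M Kb_ga s2E.
(* Each side takes the constant of the other as its parameter, so both subgroups trace on [G0] the
   multiples of [k1.+1 * k2.+1]. *)
have [M1 [nM1 M1K1 M1E]] := M1P k2; have [M2 [nM2 M2Kb M2E]] := M2P k1.
pose m := (k1.+1 * k2.+1)%N.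
have [|||||K [phi [nK phiM phiE]]] := @glue_power_cyclic _ _ _ _ _ _ _ _ am M1 M2 V w
  nM1 nM2 _ _ (fun n => ga (n * Posz m)%R) s2.
- by move=> c; rewrite M1E M2E mulnC.
- by move=> x y /M1K1[Kx _] /M1K1[Ky _]; apply: wM.
- by move=> n n'; rewrite GRing.mulrDl gaD.
- exact: M1E.
- by move=> x y /M2Kb Kx /M2Kb Ky; apply: s2M.
exists K, phi, m.-1; split=> // g /phiE[/M1K1[K1g _] ->]; split=> //.
rewrite s2E ?GRing.mul1r ?pmulrn//.
by apply: M2Kb; apply/M2E; exists 1%R; rewrite GRing.mul1r mulnC.
Qed.

Theorem amalgam_virtual_retract (H : set G1) : subgroup H -> finitely_generated H ->
  virtually_abelian H -> virtual_retract H -> virtual_retract (j1 @` H).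
Proof.
move=> sH fgH vaH vrH.
have [L [lL LH fL]] := virtually_abelian_lattice sH fgH vaH.
have [aL _ _] := lL; have [sL _] := aL.
have [K1 [r [nK1 rM rL HK1 rE]]] := virtual_retract_power sH vrH sL LH fL.
have [V [i [i_inj iD iL]]] := abelian_zmodType aL.
have [g gK] := right_inverse_on_range (0%R : V) i; pose w x := g (r x).
have wE x : K1 x -> i (w x) = r x by move=> Kx; apply: gK; rewrite iL; apply: rL.
have [sK1 _ _] := nK1.
have [|K [phi [n [nK phiM phiE]]]] := @glue_hom V K1 w nK1.
  move=> x y Kx Ky; apply: i_inj; rewrite iD !wE//; first exact: rM.
  exact: (subM sK1).
have j1_inj := amalgam_injective am.
have j1H : hom_on H j1 by move=> x y _ _; apply: gmulfM.
(* With [V] identified with [L], [phi] is the power map of exponent [n.+1] on the part of the image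
   of [H] that lies in [K]. *)
apply: (@power_virtual_retract G (j1 @` H) (j1 @` L) K (fun x => j1 (i (phi x))) n).
- exact: subgroup_image_on.
- exact: lattice_image.
- exact: image_subset.
split=> //.
- by move=> x y Kx Ky; rewrite phiM// iD gmulfM.
- by move=> x _; exists (i (phi x)) => //; rewrite -iL; exists (phi x).
- by move=> _ [[h Hh <-] /phiE[K1h _]]; exists h => //; apply: HK1.
- move=> _ [h Hh <-] /phiE[K1h ->].
  by rewrite (zmorphMn iD) wE// rE// expg1 (hom_onX sH j1H).
Qed.

End VirtuallyCyclicAmalgam.

Lemma image_generated (G T : groupType) (f : {multiplicative G -> T}) (X : set G) :
  f @` generated X = generated (f @` X).
Proof.
have fM : hom_on (generated X) f by move=> x y _ _; apply: gmulfM.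
have sX := subgroup_generated X; have sY := subgroup_generated (f @` X).
apply/seteqP; split; last first.
  apply: generated_sub; first exact: subgroup_image_on.
  by apply: image_subset; apply: sub_generated.
suff h : generated X `<=` [set x | generated (f @` X) (f x)] by move=> _ [x /h hx <-].
apply: generated_sub; last by move=> x Xx; apply: sub_generated; exists x.
split=> [|x y hx hy|x hx] /=; first by rewrite morph1; apply: (sub1 sY).
  by rewrite gmulfM; apply: (subM sY).
by rewrite morphV; apply: (subV sY).
Qed.

Lemma virtually_cyclic_range (G T : groupType) (f : {multiplicative G -> T}) :
  virtually_cyclic [set: G] ->
  finitely_generated (range f) /\ virtually_abelian (range f).
Proof.
move=> [H [[sH _ fH] [x HE]]].
have {}fH : fidx H setT by apply/finite_index_fidx.
have fM : hom_on H f by move=> y z _ _; apply: gmulfM.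
split.
  have [n [k [r [_ rk kP]]]] := fidx_reps sH Logic.I fH.
  pose X := x |` range r.
  have XT : generated X = setT.
    apply/seteqP; split=> // y _; have sX := subgroup_generated X.
    have HX : H `<=` generated X.
      by rewrite HE; apply: generated_sub => // _ ->; apply: sub_generated; left.
    rewrite -[y](mulVKg (r (k y))); apply: (subM sX).
      by apply: sub_generated; right; exists (k y).
    by apply: HX; apply/kP; rewrite ?rk.
  exists (f @` X); split; last by rewrite -image_generated XT.
  apply: finite_image; rewrite finite_setU; split; first exact: finite_set1.
  exact: finite_image.
exists (f @` H); split; last first.
  split; first exact: subgroup_image_on.
  have [_ cH] := abelian_generated1 x; rewrite -HE in cH.
  by move=> _ _ [y Hy <-] [z Hz <-]; rewrite /commute -!gmulfM cH.
split; [exact: subgroup_image_on|by move=> _ [y _ <-]; exists y|].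
apply/finite_index_fidx; [exact: subgroup_image_on|exact: (sub1 (subgroup_range f))|].
exact: fidx_range.
Qed.

(** Conjugation by [g] followed by the inverse of [j]; as [K] is normal, the image is the whole
    preimage of [K] under [j]. *)
Lemma isog_conj (G T : groupType) (j : {multiplicative T -> G}) (K : set G) g :
  injective j -> normal_fidx K ->
  isog_finite_index T [set n | K n /\ range j (g * n * g^-1)].
Proof.
move=> j_inj [sK nK fK].
have jM : hom_on setT j by move=> x y _ _; apply: gmulfM.
have sB : subgroup [set y | K (j y)].
  rewrite (_ : mkset _ = [set y | setT y /\ K (j y)]); first exact: subgroup_ker_on.
  by apply/seteqP; split=> y //= [].
exists [set y | K (j y)]; split.
  split=> //; apply/finite_index_fidx => //.
  have := fidx_preimage (subgroupT T) jM (B := setT) (fun _ _ => Logic.I) fK.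
  by apply: fidxS => // x [].
have [h0 hP0] := right_inverse_on_range (1 : T) j; pose h n := h0 (g * n * g^-1).
have hP n : range j (g * n * g^-1) -> j (h n) = g * n * g^-1 by apply: hP0.
have sR := subgroup_range j.
have rM x y : range j (g * x * g^-1) -> range j (g * y * g^-1) ->
    range j (g * (x * y) * g^-1).
  by move=> rx ry; have := subM sR rx ry; gsimp.
exists h; split.
  move=> x y [Kx rx] [Ky ry]; apply: j_inj; rewrite gmulfM !hP//; last exact: rM.
  by gsimp.
split.
- move=> x [Kx rx] /=; rewrite hP//; have := nK g^-1 x Kx; rewrite conjgE.
  by gsimp.
- move=> x y; rewrite !inE => -[_ rx] [_ ry] /(congr1 j); rewrite !hP//.
  by move=> /mulIg /mulgI.
- move=> y /= Ky; have e : g * (j y ^ g) * g^-1 = j y by rewrite conjgE; gsimp.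
  exists (j y ^ g); first by split; [apply: nK|rewrite e; exists y].
  by apply: j_inj; rewrite hP e//; exists y.
Qed.

Section Finite.
Variables (G0 G1 G2 G : groupType).
Variables (f1 : {multiplicative G0 -> G1}) (f2 : {multiplicative G0 -> G2}).
Variables (j1 : {multiplicative G1 -> G}) (j2 : {multiplicative G2 -> G}).
Hypotheses (am : amalgamated_product f1 f2 j1 j2) (vcG0 : virtually_cyclic [set: G0]).
Hypotheses (vr1 : virtual_retract (range f1)) (vr2 : virtual_retract (range f2)).

Lemma edge_virtual_retract : virtual_retract (range (j1 \o f1)).
Proof.
have [fg va] := virtually_cyclic_range f1 vcG0.
have -> : range (j1 \o f1) = j1 @` range f1 by rewrite image_comp.
exact: (amalgam_virtual_retract am vcG0 vr1 vr2 (subgroup_range f1)).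
Qed.

Theorem finite_edge_decomposition : finite_set [set: G0] ->
  exists (F : set G) (k : nat) (F_ : 'I_k.+1 -> set G),
    [/\ normal_subgroup F [set: G], finite_index_subgroup F [set: G],
        free_product F F_,
        free_group (F_ ord0) /\ finitely_generated (F_ ord0)
      & forall j : 'I_k.+1, (0 < j)%N ->
          isog_finite_index G1 (F_ j) \/ isog_finite_index G2 (F_ j)].
Proof.
move=> finG0; have [f1_inj _ _ _] := am.
have [K1 [nK1 K1f]] := edge_trivial f1_inj vr1 finG0.
(* Only the subgroup matters here, so the zero homomorphism is glued: [F] meets [G1] inside [K1]
   and, being normal, meets every conjugate of [G0] trivially. *)
have [|F [phi [n [nF _ FK1]]]] := glue_hom am vcG0 vr1 vr2 (V := int) (w := fun=> 0%R) nK1.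
  by move=> x y _ _; rewrite GRing.addr0.
have [sF nmF fF] := nF.
have [m [kap kapP]] := fF.
have [||k [F_ [fp fg fin FE]]] := amalgam_decomposition (kappa := kap) am sF.
- move=> c x /(nmF x^-1); rewrite conjgE; gsimp.
  by move=> /FK1[/K1f -> _]; rewrite !morph1.
- move=> x y /kapP Fxy; exists 1, (x^-1 * y).
  by rewrite !morph1 mul1g mulVKg; split=> //; apply: Fxy.
exists F, k, F_; split=> //.
- by split=> // x y _; apply: nmF.
- by split=> //; apply/finite_index_fidx.
move=> j /FE[g [->|->]]; [left|right]; apply: isog_conj => //.
  exact: amalgam_injective am.
exact: amalgam_injective (amalgamated_product_sym am).
Qed.
End Finite.

(** * The infinite case *)

Section Generic.
Import GRing.Theory Num.Theory.
Local Open Scope ring_scope.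

Lemma poly_nonroot (p : {poly int}) : p != 0 -> exists x : int, p.[x] != 0.
Proof.
move=> p0; apply: contrapT => np.
pose s := [seq (Posz i) | i <- iota 0 (size p)].
have := @max_poly_roots _ p s p0; rewrite size_map size_iota ltnn.
have -> : uniq s by rewrite map_inj_uniq ?iota_uniq// => i j [].
have -> // : all (root p) s; last by move=> /(_ isT isT).
apply/allP => x _; apply/rootP/eqP; apply: contrapT => px; apply: np.
by exists x; apply/negP.
Qed.

(* Take powers of an integer that avoids the roots of finitely many polynomials. *)
Lemma generic_combination (m n : nat) (B : 'I_m -> 'I_n -> int) :
  (forall j, exists i, B j i != 0) ->
  exists a : 'I_n -> int, forall j, \sum_i B j i * a i != 0.
Proof.
move=> B0.
have [|x] := @poly_nonroot (\prod_j \poly_(i < n) (if insub i is Some k then B j k else 0)).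
  apply/prodf_neq0 => j _; have [i Bi] := B0 j.
  apply/eqP => /(congr1 (fun p : {poly int} => p`_i)) /eqP.
  by rewrite coef_poly coef0 ltn_ord valK (negPf Bi).
rewrite horner_prod => /prodf_neq0 px.
exists (fun i => x ^+ i) => j; have := px j isT; rewrite horner_poly.
by under eq_bigr => i _ do rewrite valK.
Qed.
End Generic.

(** * Transport along an injective homomorphism *)

Section Transfer.
Variables (P G : groupType) (i : P -> G).
Hypotheses (i_inj : injective i) (iM : {morph i : x y / x * y}).

Let i1 : i 1 = 1.
Proof. by apply: (mulgI (i 1)); rewrite -iM !mulg1. Qed.

Let iV x : i x^-1 = (i x)^-1.
Proof. by apply: (mulgI (i x)); rewrite -iM !mulgV. Qed.

Lemma preimage_subgroup (A : set G) : subgroup A -> subgroup (i @^-1` A).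
Proof.
move=> sA; split=> [|x y Ax Ay|x Ax] /=; first by rewrite i1; apply: (sub1 sA).
  by rewrite iM; apply: (subM sA).
by rewrite iV; apply: (subV sA).
Qed.

Let retr : exists r : G -> P, cancel i r.
Proof.
have [r rP] := right_inverse_on_range (1 : P) i.
by exists r => x; apply: i_inj; apply: rP; exists x.
Qed.

Lemma preimage_hom (T : groupType) (A : set G) (f : G -> T) :
  hom_on A f -> hom_on (i @^-1` A) (f \o i).
Proof. by move=> fM x y Ax Ay /=; rewrite iM fM. Qed.

Lemma retr_hom (T : groupType) (A : set G) (r : G -> P) (f : P -> T) : cancel i r ->
  A `<=` range i -> hom_on (i @^-1` A) f -> hom_on A (f \o r).
Proof.
move=> rK Ai fM x y Ax Ay /=.
have [[u _ ux] [v _ vy]] := (Ai _ Ax, Ai _ Ay); subst x y.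
by rewrite -iM !rK fM.
Qed.

Lemma preimage_free_product (I : Type) (B : I -> set G) :
  free_product (range i) B -> free_product [set: P] (fun j => i @^-1` B j).
Proof.
move=> [sA sB U]; have [r rK] := retr.
split=> //; first by move=> j; split=> //; apply: preimage_subgroup; case: (sB j).
move=> T b bM; have [|[h [hM hb]] uh] := U T (fun j => b j \o r).
  by move=> j; apply: retr_hom => //; case: (sB j).
split.
  exists (h \o i); split.
    by move=> x y _ _ /=; rewrite iM hM//.
  by move=> j x Bx /=; rewrite (hb j)//= rK.
move=> g g' gM g'M gg' x _.
have := uh (g \o r) (g' \o r) _ _ _ (i x); rewrite /= rK; apply; last by exists x.
- by apply: retr_hom => // u v _ _; apply: gM.
- by apply: retr_hom => // u v _ _; apply: g'M.
- move=> j y By /=; apply: (gg' j) => /=.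
  by have [u _ uy] := (sB j).2 _ By; rewrite -uy rK uy.
Qed.

Lemma preimage_generated (X : set G) : X `<=` range i ->
  generated X `<=` range i -> i @^-1` generated X = generated (i @^-1` X).
Proof.
move=> Xi gi; have sX := subgroup_generated (i @^-1` X).
apply/seteqP; split; last first.
  apply: generated_sub; first exact/preimage_subgroup/subgroup_generated.
  by move=> x Xx; apply: sub_generated.
have iM' : hom_on (generated (i @^-1` X)) i by move=> x y _ _; apply: iM.
have h : generated X `<=` i @` generated (i @^-1` X).
  apply: generated_sub; first exact: subgroup_image_on.
  move=> x Xx; have [u _ ux] := Xi x Xx; exists u => //.
  by apply: sub_generated; rewrite /= ux.
by move=> x /h[y gy /i_inj <-].
Qed.

Lemma preimage_finitely_generated (A : set G) : A `<=` range i ->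
  finitely_generated A -> finitely_generated (i @^-1` A).
Proof.
move=> Ai [X [fX AX]]; have [r rK] := retr; exists (i @^-1` X); split.
  apply: sub_finite_set (finite_image r fX) => x Xx; exists (i x) => //.
rewrite AX preimage_generated//; last by rewrite -AX.
by move=> x Xx; apply: Ai; rewrite AX; apply: sub_generated.
Qed.

Lemma preimage_free_group (A : set G) : A `<=` range i ->
  free_group A -> free_group (i @^-1` A).
Proof.
move=> Ai [X [sA XA U]]; have [r rK] := retr; exists (i @^-1` X); split.
- exact: preimage_subgroup.
- by move=> x; apply: XA.
move=> T b; have [[h [hM hb]] uh] := U T (b \o r); split.
  exists (h \o i); split; first exact: preimage_hom.
  by move=> x Xx /=; rewrite hb//= rK.
move=> g g' gM g'M gg' x Ax.
have := uh (g \o r) (g' \o r) _ _ _ (i x) Ax; rewrite /= rK; apply.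
- exact: retr_hom.
- exact: retr_hom.
- move=> y Xy /=; apply: gg' => /=.
  by have [u _ uy] := Ai _ (XA _ Xy); rewrite -uy rK uy.
Qed.
End Transfer.

(** * Kernels of homomorphisms to the integers and split extensions *)

Lemma int_quotient (G : groupType) (A : set G) (chi : G -> int) :
  subgroup A -> (forall x y, A x -> A y -> chi (x * y) = (chi x + chi y)%R) ->
  (exists2 x, A x & chi x != 0%R) ->
  exists k : nat, (forall x, A x -> (Posz k.+1 %| chi x)%Z) /\
    forall q : int, exists2 x, A x & chi x = (q * k.+1)%R.
Proof.
move=> sA chiM [x0 Ax0 x0P].
have [|||k kP] := int_subgroup (P := fun n => exists2 x, A x & chi x = n).
- by exists 1; [apply: (sub1 sA)|apply: (additive_on1 sA)].
- move=> _ _ [x Ax <-] [y Ay <-]; have Ay' := subV sA Ay.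
  exists (x * y^-1); first exact: (subM sA).
  by rewrite chiM// (additive_onV sA chiM).
- by exists (chi x0) => //; exists x0.
exists k; split; last by move=> q; apply/kP; apply: dvdz_mull.
by move=> x Ax; apply/kP; exists x.
Qed.

Lemma quotient_isog_int (G : groupType) (A : set G) (chi : G -> int) :
  subgroup A -> (forall x y, A x -> A y -> chi (x * y) = (chi x + chi y)%R) ->
  (exists2 x, A x & chi x != 0%R) ->
  quotient_isog intgrp A [set x | A x /\ chi x = 0%R].
Proof.
move=> sA chiM chi0; have [k [dk chi_surj]] := int_quotient sA chiM chi0.
set M := [set x | _].
have chi1 := additive_on1 sA chiM; have chiV := additive_onV sA chiM.
(* The image of [chi] is (k+1)Z; division by [k.+1] makes the induced map onto Z. *)
pose f (C : set G) : intgrp := (chi (xget (1 : G)%g (C `&` A)) %/ k.+1)%Z.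
have fE x : A x -> f (lcoset x M) = (chi x %/ k.+1)%Z.
  move=> Ax; congr (_ %/ _)%Z.
  have [] : (lcoset x M `&` A) (xget (1 : G)%g (lcoset x M `&` A)).
    apply: xgetPex; exists x; split=> //; rewrite lcosetE mulVg.
    by split=> //; apply: (sub1 sA).
  set y := xget _ _; rewrite lcosetE => -[_ e] Ay; move/eqP: e.
  rewrite chiM ?chiV//; last exact: (subV sA).
  by rewrite GRing.addrC GRing.subr_eq0 => /eqP.
exists f; split.
  move=> x y Ax Ay; rewrite !fE//; last exact: (subM sA).
  by rewrite chiM// divzDl//; apply: dk.
split=> //.
- move=> C D; rewrite !inE => -[x Ax <-] [y Ay <-]; rewrite !fE// => e.
  have {}e : chi x = chi y.
    by have [/divzK <- /divzK <-] := (dk x Ax, dk y Ay); rewrite e.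
  have sM : subgroup M by apply: subgroup_additive_ker.
  apply: lcoset_eq => //; have Ax' := subV sA Ax.
  by split; [apply: (subM sA)|rewrite chiM// chiV// e GRing.addNr].
- move=> q _.
  have [x Ax xq] := chi_surj q; exists (lcoset x M); first by exists x.
  by rewrite fE// xq mulzK.
Qed.

Lemma int_powers (G : groupType) (t : G) : exists tau : int -> G,
  {morph tau : m n / (m + n)%R >-> m * n} /\ tau 1%R = t.
Proof.
have [V [i [_ iD iE]]] := abelian_zmodType (abelian_generated1 t).
have [v _ vt] : range i t by rewrite iE; apply: sub_generated.
exists (fun n => i (v *~ n)%R); split=> [m n|]; last by rewrite mulr1z.
by rewrite mulrzDr iD.
Qed.

Lemma sub_multiples (G : groupType) (K : set G) (tau : int -> G) b (l : int) :
  {morph tau : m n / (m + n)%R >-> m * n} -> subgroup K -> K (tau b) -> K (tau (l * b)%R).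
Proof.
move=> tauD sK Kb; have Kn (n : nat) : K (tau (Posz n * b)%R).
  rewrite GRing.mulrC -mulrzz -pmulrn (zmorphMn tauD); exact: subX.
case: l => n //; rewrite NegzE GRing.mulNr (zmorphN tauD); exact: subV.
Qed.

Section IntHom.
Variables (G : groupType) (K : set G) (F : G -> int).
Hypotheses (sK : subgroup K) (FM : forall x y, K x -> K y -> F (x * y) = (F x + F y)%R).

(** The powers of [t] split [F], and [x] corresponds to the pair of [x * (tau (F x))^-1] and [F x],
    with Z acting through conjugation by powers of [t]. *)
Lemma split_extension (P : groupType) (i : P -> G) (t : G) :
  injective i -> {morph i : x y / x * y} ->
  range i = [set x | K x /\ F x = 0%R] -> K t -> F t = 1%R ->
  exists theta : aut_action intgrp P, isog K [set: sdprod theta].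
Proof.
move=> i_inj iM iE Kt Ft.
have iP p : K (i p) /\ F (i p) = 0%R.
  have : range i (i p) by exists p.
  by rewrite iE.
have [tau [tauD tau1]] := int_powers t.
have Ktau n : K (tau n).
  by rewrite -(GRing.mulr1 n); apply: (sub_multiples n tauD sK); rewrite tau1.
have Ftau n : F (tau n) = n.
  rewrite (int_additive (F := fun n => F (tau n))); last by move=> u v; rewrite tauD FM.
  by rewrite tau1 Ft mulrzz GRing.mul1r.
have [r rP'] := right_inverse_on_range (1 : P) i.
have rP x : K x -> F x = 0%R -> i (r x) = x by move=> Kx Fx; apply: rP'; rewrite iE.
pose act (q : intgrp) (p : P) : P := r (tau q * i p * (tau q)^-1).
have actE q p : i (act q p) = tau q * i p * (tau q)^-1.
  have [Kp Fp] := iP p; have Kq := Ktau q; have Kq' := subV sK Kq.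
  apply: rP; first by do ?apply: (subM sK).
  have := additive_onJ sK FM Kp Kq'; by rewrite invgK Fp.
have actM q : {morph act q : x y / x * y}.
  by move=> x y; apply: i_inj; rewrite iM !actE iM; gsimp.
have act1 p : act 1 p = p.
  by apply: i_inj; rewrite actE (zmorph0 tauD); gsimp.
have actC (q q' : intgrp) p : act (q * q') p = act q (act q' p).
  by apply: i_inj; rewrite !actE tauD; gsimp.
pose th := AutAction actM act1 actC; exists th.
have Kx0 x : K x -> K (x * (tau (F x))^-1) /\ F (x * (tau (F x))^-1) = 0%R.
  move=> Kx; have Kq' := subV sK (Ktau (F x)).
  by split; [apply: (subM sK)|rewrite FM// (additive_onV sK FM)// Ftau GRing.subrr].
have irE x : K x -> i (r (x * (tau (F x))^-1)) = x * (tau (F x))^-1.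
  by move=> /Kx0[? ?]; apply: rP.
exists (fun x => (r (x * (tau (F x))^-1), F x) : sdprod th); split.
  move=> x y Kx Ky; congr pair; last exact: FM.
  apply: i_inj; rewrite /= iM actE !irE//; last exact: (subM sK).
  by rewrite FM// tauD; gsimp.
split=> //.
- move=> x y; rewrite !inE => Kx Ky [/(congr1 i)]; rewrite !irE// => e Fxy.
  by move: e; rewrite Fxy => /mulIg.
- move=> [p q] _; have [Kp Fp] := iP p; have Kq : K (tau q) := Ktau q.
  exists (i p * tau q); first exact: (subM sK).
  have e : F (i p * tau q) = q by rewrite FM// Fp Ftau GRing.add0r.
  by congr pair => //; apply: i_inj; rewrite irE ?e ?mulgK//; apply: (subM sK).
Qed.
End IntHom.

Section Infinite.
Variables (G0 G1 G2 G : groupType).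
Variables (f1 : {multiplicative G0 -> G1}) (f2 : {multiplicative G0 -> G2}).
Variables (j1 : {multiplicative G1 -> G}) (j2 : {multiplicative G2 -> G}).
Hypotheses (am : amalgamated_product f1 f2 j1 j2) (vcG0 : virtually_cyclic [set: G0]).
Hypotheses (vr1 : virtual_retract (range f1)) (vr2 : virtual_retract (range f2)).

(* A generic combination of the conjugates of a homomorphism that is nonzero on
   the edge group is nonzero on all conjugates of the edge group. *)
Lemma edge_faithful_hom : infinite_set [set: G0] ->
  exists (K : set G) (F : G -> int) (ga : int -> G0) (e : int),
  [/\ normal_fidx K, forall x y, K x -> K y -> F (x * y) = (F x + F y)%R,
      {morph ga : m n / (m + n)%R >-> m * n},
      K (j1 (f1 (ga e))) /\ forall g, F (j1 (f1 (ga e)) ^ g) != 0%R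
    & forall c g, K (j1 (f1 c)) -> F (j1 (f1 c) ^ g) = 0%R -> c = 1].
Proof.
move=> infG0; have [ga [gaD ga_inj fga]] := virtually_cyclic_infinite vcG0 infG0.
pose f := [the {multiplicative _ -> _} of j1 \o f1].
have f_inj : injective f.
  by apply: inj_comp; [exact: amalgam_injective am|case: am].
have vrf : virtual_retract (range f) := edge_virtual_retract am vcG0 vr1 vr2.
have [K [s [nK sM Kga sE]]] := edge_cyclic f_inj vrf gaD ga_inj fga.
have [sK nmK fK] := nK.
have [e eK] := fidx_exp sK (subgroupT G) fK.
have fgD : {morph f \o ga : m n / (m + n)%R >-> m * n}.
  by move=> m n /=; rewrite gaD !gmulfM.
have Ky : K (f (ga e.+1)).
  have := eK (f (ga 1%R)) Logic.I; rewrite -[f (ga 1%R)]/((f \o ga) 1%R) -(zmorphMn fgD).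
  by rewrite pmulrn mulrzz GRing.mul1r.
pose y := f (ga e.+1).
have [n [k [r [_ rk kP]]]] := fidx_reps sK Logic.I fK.
have {}kP x x' : k x = k x' <-> K (x^-1 * x') by apply: kP.
have Kyg g : K (y ^ g) by apply: nmK.
have s_conj x g : K x -> K g -> s (x ^ g) = s x.
  by move=> Kx Kg; rewrite conjgE mulgA (additive_onJ sK sM).
have [|a aP] := @generic_combination n n (fun j i => s (y ^ (r j * r i))%g).
  (* For this index [z] lies in [K], under whose conjugation [s] is invariant, so the entry is the
     value [e.+1] of [s] at [y]. *)
  move=> j; exists (k (r j)^-1); set z := r j * _.
  have Kz : K z by have := (kP (r j)^-1 (r (k (r j)^-1))).1; rewrite invgK; apply; rewrite rk.
  by rewrite s_conj// /y sE.
pose F x := (\sum_i s (x ^ r i)%g * a i)%R.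
have FM x x' : K x -> K x' -> F (x * x') = (F x + F x')%R.
  move=> Kx Kx'; rewrite /F -big_split; apply: eq_bigr => i _ /=.
  by rewrite conjMg sM ?GRing.mulrDl//; apply: nmK.
have F_y g : F (y ^ g) != 0%R.
  have Kg : K ((r (k g))^-1 * g) by apply/kP.
  rewrite -[g](mulVKg (r (k g))) conjgM conjgE mulgA (additive_onJ sK FM)//.
  by have := aP (k g); under eq_bigr do rewrite conjgM.
exists K, F, ga, e.+1; split=> // c g Kc Fc.
have [m cm] := Kga c Kc.
have F_lin (b : int) (l : int) : K (f (ga b)) -> F (f (ga (l * b)%R) ^ g) = (F (f (ga b) ^ g)%g * l)%R.
  move=> Kb; have Kl (l' : int) : K (f (ga (l' * b)%R)).
    exact: (sub_multiples (tau := f \o ga) l' fgD sK).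
  rewrite (int_additive (F := fun l => F (f (ga (l * b)%R) ^ g))); last first.
    by move=> u v; rewrite GRing.mulrDl -[f _]/((f \o ga) _) fgD conjMg FM//; apply: nmK; apply: Kl.
  by rewrite GRing.mul1r mulrzz.
(* With [c = ga m], the value of [F] at the conjugate of [ga (m * e.+1)] is computed in two ways: as
   [m] times a nonzero integer, and as a multiple of [F (f c ^ g) = 0]. *)
have := F_lin e.+1 m Ky; rewrite GRing.mulrC F_lin -?cm// Fc GRing.mul0r.
move/esym/eqP; rewrite GRing.mulf_eq0 (negPf (F_y g)) /= => /eqP m0.
by rewrite cm m0 (zmorph0 gaD).
Qed.
End Infinite.

(** Conjugation by [g] carries the factor onto the kernel of [F (x ^ g)] on the part of [A] in [K];
    as this homomorphism is nonzero, the quotient is infinite cyclic. *)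
Lemma isog_cocyclic_conj (P G : groupType) (i : P -> G) (A K : set G) (F : G -> int) g :
  injective i -> {morph i : x y / x * y} -> normal_fidx K -> subgroup A ->
  (forall x y, K x -> K y -> F (x * y) = (F x + F y)%R) ->
  range i = [set x | K x /\ F x = 0%R] ->
  (exists x, [/\ A x, K x & F (x ^ g) != 0%R]) ->
  isog_cocyclic_normal
    (i @^-1` [set n | [set x | K x /\ F x = 0%R] n /\ A (g * n * g^-1)]) (A `&` K).
Proof.
move=> i_inj iM [sK nK fK] sA FM iE [x0 [Ax0 Kx0 x0P]].
pose chi x := F (x ^ g).
have sAK : subgroup (A `&` K) by apply: subgroupI.
have chiM x y : (A `&` K) x -> (A `&` K) y -> chi (x * y) = (chi x + chi y)%R.
  by move=> [_ Kx] [_ Ky]; rewrite /chi conjMg FM//; apply: nK.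
exists [set x | (A `&` K) x /\ chi x = 0%R]; split.
- split; [exact: subgroup_additive_ker|by move=> x []|].
  move=> x y AKx [AKy y0]; split.
    rewrite conjgE mulgA; apply: (subM sAK) => //; apply: (subM sAK) => //.
    exact: (subV sAK).
  by rewrite conjgE mulgA (additive_onJ sAK chiM).
- by apply: quotient_isog_int => //; exists x0.
have gE x : (g * x * g^-1) ^ g = x by rewrite conjgE; gsimp.
exists (fun p => g * i p * g^-1); split.
  by move=> x y _ _; rewrite iM; gsimp.
split.
- move=> p [[Kp Fp] Ap]; rewrite /= /chi gE; split=> //; split=> //.
  by have := nK g^-1 _ Kp; rewrite conjgE; gsimp.
- by move=> x y _ _ /mulIg /mulgI /i_inj.
- move=> x [[Ax Kx] Fx]; have [p _ px] : range i (x ^ g) by rewrite iE; split=> //; apply: nK.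
  have e : g * i p * g^-1 = x by rewrite px conjgE; gsimp.
  exists p => //; rewrite /= e; split=> //.
  by rewrite px; split=> //; apply: nK.
Qed.

Section Infinite.
Variables (G0 G1 G2 G : groupType).
Variables (f1 : {multiplicative G0 -> G1}) (f2 : {multiplicative G0 -> G2}).
Variables (j1 : {multiplicative G1 -> G}) (j2 : {multiplicative G2 -> G}).
Hypotheses (am : amalgamated_product f1 f2 j1 j2) (vcG0 : virtually_cyclic [set: G0]).
Hypotheses (vr1 : virtual_retract (range f1)) (vr2 : virtual_retract (range f2)).

Theorem infinite_edge_decomposition : infinite_set [set: G0] ->
  exists (K : set G) (k : nat) (P : groupType) (N_ : 'I_k.+1 -> set P)
         (theta : aut_action intgrp P),
    [/\ normal_subgroup K [set: G] /\ finite_index_subgroup K [set: G],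
        isog K [set: sdprod theta],
        free_product [set: P] N_,
        free_group (N_ ord0) /\ finitely_generated (N_ ord0)
      & forall j : 'I_k.+1, (0 < j)%N ->
          isog_cocyclic_normal (N_ j) (range j1 `&` K) \/
          isog_cocyclic_normal (N_ j) (range j2 `&` K)].
Proof.
move=> infG0.
have [K [F0 [ga [e [nK F0M gaD [Ky F0y] F0free]]]]] :=
  edge_faithful_hom am vcG0 vr1 vr2 infG0.
have [sK nmK fK] := nK.
pose f := [the {multiplicative _ -> _} of j1 \o f1].
pose y := f (ga e).
(* Division by [D.+1] makes the homomorphism onto Z without changing its kernel, so that [K] splits
   over that kernel. *)
have [|D [D_dvd D_surj]] := int_quotient sK F0M.
  by exists y => //; have := F0y 1; rewrite conjg1.
pose F x := (F0 x %/ D.+1)%Z.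
have FD x : K x -> (F x * D.+1)%R = F0 x by move=> Kx; apply/divzK/D_dvd.
have FM x x' : K x -> K x' -> F (x * x') = (F x + F x')%R.
  by move=> Kx Kx'; rewrite /F F0M// divzDl//; apply: D_dvd.
have [t Kt Ft0] := D_surj 1%R.
have Ft : F t = 1%R by rewrite /F Ft0 mulzK.
have Kyg g : K (y ^ g) by apply: nmK.
have Fy g : F (y ^ g) != 0%R.
  by apply/eqP => Fy0; have := F0y g; rewrite -FD// Fy0 GRing.mul0r eqxx.
pose N := [set x | K x /\ F x = 0%R].
have sN : subgroup N by apply: subgroup_additive_ker.
have [n [k [r [_ rk kP]]]] := fidx_reps sK Logic.I fK.
have {}kP x x' : k x = k x' <-> K (x^-1 * x') by apply: kP.
(* A common multiple of the values of [F] on the conjugates of [y]. The coset of [x] modulo [K]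
   together with a value of [F] modulo [M] then determines the double coset of [x]. *)
pose M := (\prod_i `|F (y ^ r i)%g|)%N.
have [res resP] := int_residue M.-1.
have M_gt0 : (0 < M)%N by rewrite prodn_cond_gt0// => i _; rewrite absz_gt0.
pose kap x := enum_rank (k x, res (F ((r (k x))^-1 * x))).
have [||m [N_ [fp fg fin NE]]] := amalgam_decomposition (kappa := kap) am sN.
- move=> c x; rewrite -mulgA -conjgE => -[Kc Fc].
  have Kc' : K (f c) by have := nmK x^-1 _ Kc; rewrite -conjgM mulgV conjg1.
  have -> : c = 1; last by rewrite !morph1.
  by apply: (F0free c x Kc'); rewrite -FD// Fc GRing.mul0r.
- move=> x x' /enum_rank_inj[kxx']; set i := k x in kxx' *; rewrite -kxx' => /resP.
  rewrite prednK// => dM.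
  have Kx : K ((r i)^-1 * x) by apply/kP; rewrite rk.
  have Kx' : K ((r i)^-1 * x') by apply/kP; rewrite rk.
  (* Left multiplication of [x] by the edge element [f (ga (l * e))] adds [l] times the value at
     [y ^ r i] to [F ((r i)^-1 * x)]; this makes up the difference with [x']. *)
  have /dvdzP[l lE] : (F (y ^ r i)%g %| (F ((r i)^-1 * x')%g - F ((r i)^-1 * x)%g)%R)%Z.
    by apply: dvdz_trans dM; rewrite dvdzE /M (bigD1 i)//= dvdn_mulr.
  have fgD : {morph f \o ga : m n / (m + n)%R >-> m * n}.
    by move=> u v /=; rewrite gaD !gmulfM.
  have Kl (b : int) : K (f (ga (b * e)%R)) by apply: (sub_multiples (tau := f \o ga) b fgD sK).
  have Fl : F (f (ga (l * e)%R) ^ r i) = (l * F (y ^ r i)%g)%R.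
    rewrite (int_additive (F := fun l => F (f (ga (l * e)%R) ^ r i))); last first.
      move=> u v; rewrite GRing.mulrDl -[f _]/((f \o ga) _) fgD conjMg FM//; apply: nmK; exact: Kl.
    by rewrite GRing.mul1r mulrzz GRing.mulrC.
  set z := f (ga (l * e)%R) in Fl.
  exists (ga (l * e)%R), ((z * x)^-1 * x'); split; last by rewrite mulVKg.
  have Kz : K (z ^ r i) by apply/nmK/Kl.
  have -> : (z * x)^-1 * x' = ((z ^ r i) * ((r i)^-1 * x))^-1 * ((r i)^-1 * x').
    by rewrite conjgE; gsimp.
  have Kzx := subM sK Kz Kx; have Kzx' := subV sK Kzx.
  split; first exact: (subM sK).
  rewrite FM// (additive_onV sK FM)// FM// Fl -lE.
  by rewrite GRing.subrK GRing.addNr.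
have [P [i [i_inj iM iE]]] := subgroup_groupType sN.
have [theta thetaP] := split_extension sK FM i_inj iM iE Kt Ft.
have N_sub j : N_ j `<=` range i.
  by rewrite iE; case: fp => _ /(_ j)[].
exists K, m, P, (fun j => i @^-1` N_ j), theta; split=> //.
- split; first by split=> // x z _; apply: nmK.
  by split=> //; apply/finite_index_fidx.
- by apply: preimage_free_product => //; rewrite iE.
- split; first by apply: preimage_free_group.
  by apply: preimage_finitely_generated.
move=> j /NE[g [->|->]]; [left|right].
  apply: isog_cocyclic_conj => //; first exact: subgroup_range.
  by exists y; split=> //; exists (f1 (ga e)).
apply: isog_cocyclic_conj => //; first exact: subgroup_range.
exists y; split=> //; exists (f2 (ga e)) => //.
by case: am => _ _ /(_ (ga e)) /= <-.
Qed.
End Infinite.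

Theorem corollary6p3 (G0 G1 G2 G : groupType)
    (f1 : {multiplicative G0 -> G1}) (f2 : {multiplicative G0 -> G2})
    (j1 : {multiplicative G1 -> G}) (j2 : {multiplicative G2 -> G})
    (amalgG : amalgamated_product f1 f2 j1 j2)
    (vcG0 : virtually_cyclic [set: G0])
    (vrG1 : virtual_retract (range f1))
    (vrG2 : virtual_retract (range f2)) :
  [/\ (* (i) *)
      [/\ forall H : set G1, subgroup H -> finitely_generated H ->
            virtually_abelian H -> virtual_retract H ->
            virtual_retract (j1 @` H),
          forall H : set G2, subgroup H -> finitely_generated H ->
            virtually_abelian H -> virtual_retract H ->
            virtual_retract (j2 @` H)
        & virtual_retract (range (j1 \o f1))],
      (* (ii) *)
      finite_set [set: G0] ->
      exists (F : set G) (k : nat) (F_ : 'I_k.+1 -> set G),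
        [/\ normal_subgroup F [set: G], finite_index_subgroup F [set: G],
            free_product F F_,
            free_group (F_ ord0) /\ finitely_generated (F_ ord0)
          & forall j : 'I_k.+1, (0 < j)%N ->
              isog_finite_index G1 (F_ j) \/ isog_finite_index G2 (F_ j)]
    & (* (iii) *)
      infinite_set [set: G0] ->
      exists (K : set G) (k : nat) (P : groupType) (N_ : 'I_k.+1 -> set P)
             (theta : aut_action intgrp P),
        [/\ normal_subgroup K [set: G] /\ finite_index_subgroup K [set: G],
            isog K [set: sdprod theta],
            free_product [set: P] N_,
            free_group (N_ ord0) /\ finitely_generated (N_ ord0)
          & forall j : 'I_k.+1, (0 < j)%N ->
              isog_cocyclic_normal (N_ j) (range j1 `&` K) \/
              isog_cocyclic_normal (N_ j) (range j2 `&` K)]].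
Proof.
split.
- split.
  + exact: amalgam_virtual_retract amalgG vcG0 vrG1 vrG2.
  + exact: amalgam_virtual_retract (amalgamated_product_sym amalgG) vcG0 vrG2 vrG1.
  + exact: edge_virtual_retract amalgG vcG0 vrG1 vrG2.
- exact: finite_edge_decomposition amalgG vcG0 vrG1 vrG2.
- exact: infinite_edge_decomposition amalgG vcG0 vrG1 vrG2.
Qed.
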